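(* Let $p$ be a prime, let $n,d$ be positive integers, let $\delta\in(0,1]$ be a distance parameter, and let $t$ be an erasure parameter with $t \leq \frac{\delta}{30}p^{n/(20d)}$. Then there is a $t$-online-erasure-resilient tester for degree $d$ for functions $f:\mathbb{F}_p^n\to\mathbb{F}_p$ with query complexity $O\!\left(\frac{\log^{3d+3}(t/\delta)}{\delta}\right)$, satisfying: (Completeness) if $f$ has degree at most $d$, the tester accepts with probability $1$; (Soundness) if $f$ is $\delta$-far from degree $d$, the tester rejects with probability at least $2/3$.
   Context: Every function $f:\mathbb{F}_q^n\to\mathbb{F}_q$ has a unique polynomial representation $f(x)=\sum_{e\in\{0,\dots,q-1\}^n} C_e x^e$ with $x^e=\prod_i x_i^{e_i}$; its degree is $\max\{|e|_1 : C_e\neq 0\}$ where $|e|_1=\sum_i e_i$. For $f,g$ on $\mathbb{F}_q^n$, $\delta(f,g)=\Pr_{x\in\mathbb{F}_q^n}[f(x)\neq g(x)]$ (uniform $x$), and $f$ is $\delta$-far from degree $d$ if $\min_{g:\deg g\le d}\delta(f,g)\geq \delta$. The $t$-online-erasure model: a (randomized, adaptive) tester receives parameters $n,d,\delta,t$ and query access to $f$. Initially no entry of the truth table of $f$ is erased. The tester queries points $x$ one at a time; after each query, an adversary (who may know all queries so far) may erase any $t$ entries of the truth table of $f$. A query to an erased point returns the symbol $\perp$; otherwise it returns $f(x)$. A tester is $t$-online-erasure-resilient if its completeness and soundness guarantees hold against every such adversary. The query complexity is the number of queries made. *)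

(* Defs.v *)
From HB Require Import structures.
From mathcomp Require Import all_boot all_order all_algebra.
From mathcomp Require Import reals exp.
Set Implicit Arguments. Unset Strict Implicit. Unset Printing Implicit Defensive.
Import Order.TTheory GRing.Theory Num.Theory.
Local Open Scope ring_scope.

Section OnlineErasure.
Variables (p n : nat).

(* Points of F_p^n and answers (None = the erasure symbol "bottom"). *)
Definition point := 'rV['F_p]_n.
Definition answer := option 'F_p.

Definition monomial (e : {ffun 'I_n -> 'I_p}) (x : point) : 'F_p :=
  \prod_(i < n) (x ord0 i) ^+ (e i : nat).

Definition mdeg (e : {ffun 'I_n -> 'I_p}) : nat := (\sum_(i < n) (e i : nat))%N.

(* deg f <= d : the (unique) representation f = sum_e C_e x^e with
   e in {0..p-1}^n has C_e = 0 whenever |e|_1 > d. *)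
Definition deg_le (d : nat) (f : point -> 'F_p) : Prop :=
  exists C : {ffun 'I_n -> 'I_p} -> 'F_p,
    (forall e, C e != 0 -> (mdeg e <= d)%N) /\
    (forall x, f x = \sum_(e : {ffun 'I_n -> 'I_p}) C e * monomial e x).

Definition fdist (R : realType) (f g : point -> 'F_p) : R :=
  #|[set x : point | f x != g x]|%:R / #|{: point}|%:R.

Definition far_from_deg (R : realType) (delta : R) (d : nat)
    (f : point -> 'F_p) : Prop :=
  forall g, deg_le d g -> delta <= fdist R f g.

(* A (deterministic) t-adversary: after each query, seeing the sequence of
   all queries made so far, it erases (at most) t entries of the table. *)
Definition valid_adversary (t : nat) (adv : seq point -> {set point}) : Prop :=
  forall s, (#|adv s| <= t)%N.

(* State of the interaction: (queries so far, answers so far, erased set). *)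
Definition state := (seq point * seq answer * {set point})%type.

Definition step (f : point -> 'F_p) (qry : seq answer -> point)
    (adv : seq point -> {set point}) (st : state) : state :=
  let: (qs, ans, er) := st in
  let x := qry ans in
  let a := if x \in er then None else Some (f x) in
  let qs' := rcons qs x in
  (qs', rcons ans a, er :|: adv qs').

Definition run_answers (q : nat) (f : point -> 'F_p)
    (qry : seq answer -> point) (adv : seq point -> {set point}) : seq answer :=
  (iter q (step f qry adv) ([::], [::], set0)).1.2.

(* A randomized tester making q queries: a finite probability space of coins
   (Omega, w); for each coin outcome a deterministic adaptive query strategy
   qry and a decision dec (true = accept) on the q answers.
   Probability of acceptance of f against adversary adv: *)
Definition accept_prob (R : realType) (Omega : finType) (w : Omega -> R)
    (q : nat) (qry : Omega -> seq answer -> point)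
    (dec : Omega -> seq answer -> bool)
    (f : point -> 'F_p) (adv : seq point -> {set point}) : R :=
  \sum_(o : Omega) w o * (dec o (run_answers q f (qry o) adv))%:R.

Definition is_distribution (R : realType) (Omega : finType) (w : Omega -> R) :=
  (forall o, 0 <= w o) /\ \sum_(o : Omega) w o = 1.

End OnlineErasure.

(* Main.v *)
(* The test repeats the following block.  Draw a uniformly random affine map
   [a] from F_p^m to F_p^n with m = O(d log_p (t / delta)), query f at the images
   of s + 1 independent uniform points of F_p^m, and reject if the answers that
   were not erased agree with no polynomial of degree at most d on F_p^m.

   Erasures: given everything seen before, each query is uniform on the image of
   [a], which has about p^m points, while the adversary has erased only t points
   per earlier query; a union bound shows that with high probability no query at
   all is erased.

   Soundness: let eps be the probability that a random (d+1)-dimensional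
   parallelepiped has nonzero alternating sum of f.  If eps is small, local
   correction g(x) := f(x) - (alternating sum at x in suitable directions) has all
   (d+1)-fold derivatives zero, so deg g <= d, and g is 2 eps-close to f; hence
   eps is at least a constant times delta.  A parallelepiped can be drawn inside
   the random subspace, so the expected distance of the pulled-back function from
   degree d is also of order delta.  A nonzero polynomial of degree at most d is
   nonzero with density at least 2^-d, hence s = O(m^d) random points determine it,
   and the last point detects the remaining distance. *)
Require Import Defs.
From HB Require Import structures.
From mathcomp Require Import all_boot all_order all_algebra.
From mathcomp Require Import reals sequences exp boolp.
From mathcomp Require Import ring lra zify.
Import Order.TTheory GRing.Theory Num.Theory.
Set Implicit Arguments. Unset Strict Implicit. Unset Printing Implicit Defensive.
Local Open Scope ring_scope.

(** * Averages over finite types *)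

Section Average.
Variable R : realFieldType.

Definition avg (T : finType) (F : T -> R) : R := (\sum_x F x) / #|T|%:R.

Lemma ler_avg (T : finType) (F G : T -> R) :
  (forall x, F x <= G x) -> avg F <= avg G.
Proof. by move=> FG; rewrite /avg ler_wpM2r ?invr_ge0 ?ler0n// ler_sum. Qed.

Lemma eq_avg (T : finType) (F G : T -> R) : F =1 G -> avg F = avg G.
Proof. by move=> FG; rewrite /avg (eq_bigr G). Qed.

Lemma avgD (T : finType) (F G : T -> R) :
  avg (fun x => F x + G x) = avg F + avg G.
Proof. by rewrite /avg big_split mulrDl. Qed.

Lemma avgZ (T : finType) c (F : T -> R) : avg (fun x => c * F x) = c * avg F.
Proof. by rewrite /avg -mulr_sumr mulrA. Qed.

Lemma avg_sum (T I : finType) (F : I -> T -> R) :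
  avg (fun x => \sum_i F i x) = \sum_i avg (F i).
Proof. by rewrite /avg exchange_big mulr_suml. Qed.

Lemma avg_cst (T : finType) (x0 : T) (c : R) : avg (fun _ : T => c) = c.
Proof.
have Tgt0 : (0 < #|T|)%N by apply/card_gt0P; exists x0.
by rewrite /avg sumr_const -[c *+ _]mulr_natr mulfK // pnatr_eq0 -lt0n.
Qed.

Lemma avg_ge0 (T : finType) (F : T -> R) : (forall x, 0 <= F x) -> 0 <= avg F.
Proof. by move=> F0; rewrite divr_ge0 ?ler0n ?sumr_ge0. Qed.

Lemma avg_pair (T U : finType) (F : T * U -> R) :
  avg F = avg (fun x => avg (fun y => F (x, y))).
Proof.
rewrite /avg card_prod natrM invfM -mulr_suml mulrA -mulrA -[in RHS]mulrA.
congr (_ * _); last by rewrite mulrC.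
by rewrite pair_bigA; apply: eq_bigr => -[].
Qed.

Lemma avg_exchange (T U : finType) (F : T -> U -> R) :
  avg (fun x => avg (F x)) = avg (fun y => avg (F^~ y)).
Proof. by rewrite /avg -!mulr_suml exchange_big mulrAC. Qed.

(* A map hitting every value equally often: [act] moves the argument of [phi]
   so that its value sweeps over [U]. *)
Lemma avg_push (T U : finType) (t0 : T) (act : U -> T -> T) (phi : T -> U)
    (F : U -> R) :
    (forall u, injective (act u)) ->
    (forall x, injective (fun u => phi (act u x))) ->
  avg (fun x => F (phi x)) = avg F.
Proof.
move=> act_inj phi_inj; rewrite -[LHS](avg_cst (phi t0)).
have -> : avg (fun _ : U => avg (fun x => F (phi x)))
        = avg (fun u => avg (fun x => F (phi (act u x)))).
  apply: eq_avg => u; congr (_ / _).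
  by rewrite (reindex_inj (act_inj u)).
rewrite avg_exchange -[RHS](avg_cst t0); apply: eq_avg => x.
by congr (_ / _); rewrite [RHS](reindex_inj (phi_inj x)).
Qed.

Lemma avg_inj (T : finType) (h : T -> T) (F : T -> R) :
  injective h -> avg (fun x => F (h x)) = avg F.
Proof. by move=> hI; congr (_ / _); rewrite [RHS](reindex_inj hI). Qed.

Definition ffun_upd (I T : finType) (f : {ffun I -> T}) (i : I) (y : T) :
  {ffun I -> T} := [ffun j => if j == i then y else f j].

(** Exchanging the entry at [i] with a fresh value is injective on pairs, so resampling one entry of
    a uniform function keeps it uniform. *)
Lemma avg_ffun_upd (I T : finType) (i : I) (F : {ffun I -> T} -> R) :
  avg F = avg (fun f => avg (fun y => F (ffun_upd f i y))).
Proof.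
have [[f0 _]|U0] := pselect (exists f : {ffun I -> T}, True); last first.
  by rewrite /avg !big1 // => f _; case: U0; exists f.
rewrite -(avg_pair (fun z : _ * _ => F (ffun_upd z.1 i z.2))).
have hI : injective (fun z : {ffun I -> T} * T => (ffun_upd z.1 i z.2, z.1 i)).
  move=> [f y] [g z] /= [/ffunP e fg].
  have := e i; rewrite !ffunE eqxx => <-; congr (_, _); apply/ffunP => j.
  by have [->//|ji] := eqVneq j i; have := e j; rewrite !ffunE (negPf ji).
rewrite -[RHS](avg_inj _ hI) avg_pair; apply: eq_avg => f /=.
rewrite -[LHS](avg_cst (f0 i)); apply: eq_avg => y; congr F.
by apply/ffunP => j; rewrite !ffunE; case: eqP => [->|].
Qed.

Lemma avg_ffun_prod (I T : finType) (F : I -> T -> R) :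
  avg (fun f : {ffun I -> T} => \prod_i F i (f i)) = \prod_i avg (F i).
Proof.
rewrite /avg big_split /= bigA_distr_bigA prodr_const cardT -cardE.
by rewrite card_ffun natrX exprVn.
Qed.

Lemma exists_le_avg (T : finType) (x0 : T) (F : T -> R) : exists x, F x <= avg F.
Proof.
apply: contrapT => /forallNP noF.
have : \sum_(x : T) avg F < \sum_x F x.
  apply: ltr_sum => [|x _]; first by apply/hasP; exists x0; rewrite ?mem_index_enum.
  by rewrite ltNge; apply/negP/noF.
have Tgt0 : (0 < #|T|)%N by apply/card_gt0P; exists x0.
by rewrite sumr_const -mulr_natr divfK ?ltxx // pnatr_eq0 -lt0n.
Qed.

Lemma avg_indicator (T : finType) (P : pred T) :
  avg (fun x => (P x)%:R) = #|P|%:R / #|T|%:R.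
Proof.
congr (_ / _); rewrite -sum1_card natr_sum [RHS]big_mkcond /=.
by apply: eq_bigr => x _; rewrite unfold_in; case: (P x).
Qed.

Lemma avg_indicator_le1 (T : finType) (P : pred T) :
  avg (fun x => (P x)%:R) <= 1.
Proof.
rewrite avg_indicator; have [->|T0] := posnP #|T|; first by rewrite invr0 mulr0 ler01.
by rewrite ler_pdivrMr ?ltr0n // mul1r ler_nat max_card.
Qed.

End Average.

(** * Iterated finite differences *)

Section Derivatives.
Variables (V : zmodType) (K : comNzRingType).
Implicit Types (f g : V -> K) (h x : V).

Definition fdiff h f x := f (x + h) - f x.

(** [vanish d.+1] is the coordinate-free form of degree at most d; it makes sense on any abelian
    group and is stable under affine substitution. *)
Fixpoint vanish k f : Prop :=
  if k is k'.+1 then forall h, vanish k' (fdiff h f) else forall x, f x = 0.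

Lemma eq_vanish k f g : f =1 g -> vanish k f -> vanish k g.
Proof.
elim: k f g => [|k IH] f g fg /= vf; first by move=> x; rewrite -fg.
by move=> h; apply: IH (vf h) => x; rewrite /fdiff !fg.
Qed.

Lemma vanish0 k f : (forall x, f x = 0) -> vanish k f.
Proof. by elim: k f => //= k IH f f0 h; apply: IH => x; rewrite /fdiff !f0 subrr. Qed.

Lemma vanishW k l f : (k <= l)%N -> vanish k f -> vanish l f.
Proof.
elim: k l f => [|k IH] [|l] f //= kl vf; last by move=> h; apply: IH.
by move=> h; apply: vanish0 => x; rewrite /fdiff !vf subrr.
Qed.

Lemma vanishD k f g : vanish k f -> vanish k g -> vanish k (fun x => f x + g x).
Proof.
elim: k f g => [|k IH] f g /= vf vg; first by move=> x; rewrite vf vg addr0.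
move=> h; apply: eq_vanish (IH _ _ (vf h) (vg h)) => x.
by rewrite /fdiff opprD addrACA.
Qed.

Lemma vanishZ k c f : vanish k f -> vanish k (fun x => c * f x).
Proof.
elim: k f => [|k IH] f /= vf; first by move=> x; rewrite vf mulr0.
by move=> h; apply: eq_vanish (IH _ (vf h)) => x; rewrite /fdiff mulrBr.
Qed.

Lemma vanish_shift k f y : vanish k f -> vanish k (fun x => f (x + y)).
Proof.
elim: k f => [|k IH] f /= vf; first by move=> x.
by move=> h; apply: eq_vanish (IH _ (vf h)) => x; rewrite /fdiff addrAC.
Qed.

Lemma vanish_cst c : vanish 1 (fun=> c).
Proof. by move=> h x; rewrite /fdiff subrr. Qed.

(** Discrete Leibniz rule: the difference of a product is a sum of two products, each with one
    degree less. A constant factor has difference 0, which covers the cases where [a] or [b] is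
    0. *)
Lemma vanishM a b f g :
  vanish a.+1 f -> vanish b.+1 g -> vanish (a + b).+1 (fun x => f x * g x).
Proof.
move: {-1}(a + b)%N (erefl (a + b)%N) => N; elim: N a b f g => [|N IH] a b f g abN vf vg h.
  case: a b abN vf vg => [|a] [|b] // _ vf vg x.
  by rewrite /fdiff -(subrK (f x) (f _)) -(subrK (g x) (g _)) [f _ - _]vf
    [g _ - _]vg !add0r subrr.
change (vanish N.+1 (fdiff h (fun x => f x * g x))).
apply: (eq_vanish (f := fun x => fdiff h f x * g x + f (x + h) * fdiff h g x)).
  by move=> x; rewrite /fdiff; ring.
apply: vanishD.
  case: a abN vf => [|a] abN vf; last by apply: (IH a b) => //; lia.
  by apply: vanish0 => x; rewrite (vf h x) mul0r.
case: b abN vg => [|b] abN vg; last first.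
  by apply: (IH a b) => //; [lia|apply: vanish_shift].
by apply: vanish0 => x; rewrite (vg h x) mulr0.
Qed.

Lemma vanish_sum k (I : Type) (r : seq I) (P : pred I) (F : I -> V -> K) :
  (forall i, P i -> vanish k (F i)) -> vanish k (fun x => \sum_(i <- r | P i) F i x).
Proof.
move=> vF; elim: r => [|i r IH].
  by apply: vanish0 => x; rewrite big_nil.
case Pi: (P i); last by apply: eq_vanish IH => x; rewrite big_cons Pi.
by apply: eq_vanish (vanishD (vF i Pi) IH) => x; rewrite big_cons Pi.
Qed.

Lemma vanish_prod (I : Type) (r : seq I) (D : I -> nat) (F : I -> V -> K) :
    (forall i, vanish (D i).+1 (F i)) ->
  vanish (\sum_(i <- r) D i).+1 (fun x => \prod_(i <- r) F i x).
Proof.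
move=> vF; elim: r => [|i r IH].
  by apply: (eq_vanish (f := fun=> 1)); [move=> x; rewrite big_nil|rewrite big_nil; apply: vanish_cst].
rewrite big_cons.
by apply: eq_vanish (vanishM (vF i) IH) => x; rewrite big_cons.
Qed.

End Derivatives.

(** [phi] is affine with linear part [psi]: differencing the composite along [h] amounts to
    differencing [f] along [psi h]. *)
Lemma vanish_comp (V U : zmodType) (K : comNzRingType) k (f : V -> K)
    (phi : U -> V) (psi : U -> V) :
    (forall x h, phi (x + h) = phi x + psi h) ->
  vanish k f -> vanish k (fun x => f (phi x)).
Proof.
move=> phiD; elim: k f => [|k IH] f /= vf; first by move=> x.
move=> h; apply: eq_vanish (IH _ (vf (psi h))) => x.
by rewrite /fdiff phiD.
Qed.

(** * Alternating sums over parallelepipeds *)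

Section Cube.
Variables (V : zmodType) (K : comNzRingType) (I : finType).
Implicit Types (f g : V -> K) (x : V) (H : I -> V) (J : {set I}).

(** Up to sign, the iterated difference of [f] along the directions [H j]. Keeping a subset [J] of
    the index type lets directions be removed one at a time. *)
Definition cube J H f x : K :=
  \sum_(S : {set I} | S \subset J) (-1) ^+ #|S| * f (x + \sum_(j in S) H j).

Lemma eq_cube J H H' f g x : {in J, H =1 H'} -> f =1 g ->
  cube J H f x = cube J H' g x.
Proof.
move=> HH fg; apply: eq_bigr => S /subsetP SJ; rewrite fg; congr (_ * g (_ + _)).
by apply: eq_bigr => j jS; rewrite HH // SJ.
Qed.

Lemma cubeU1 i J H f x : i \notin J ->
  cube (i |: J) H f x = cube J H f x - cube J H f (x + H i).
Proof.
move=> iJ; rewrite /cube (bigID (fun S : {set I} => i \in S)) /= addrC.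
congr (_ + _).
  apply: eq_bigl => S; apply/andP/idP => [[SJ iS]|SJ].
    by rewrite -(setU1K iJ) subsetD1 SJ.
  split; first by rewrite (subset_trans SJ) // subsetUr.
  by apply: contra iJ => /(subsetP SJ).
rewrite (reindex_onto (fun S => i |: S) (fun S => S :\ i)) /=; last first.
  by move=> S /andP[_ iS]; rewrite setD1K.
rewrite -sumrN; apply: eq_big => [S|S].
  rewrite setU11 andbT; apply/andP/idP => [[SJ /eqP e]|SJ].
    have iS : i \notin S by rewrite -e !inE eqxx.
    by rewrite -(setU1K iJ) subsetD1 iS andbT (subset_trans (subsetUr _ _) SJ).
  rewrite setUS // setU1K //; by apply: contra iJ => /(subsetP SJ).
move=> /andP[_ /eqP e]; have iS : i \notin S by rewrite -e !inE eqxx.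
by rewrite cardsU1 iS exprD expr1 mulN1r mulNr big_setU1 //= addrA.
Qed.

Lemma cube_fdiff i J H f x : i \notin J ->
  cube (i |: J) H f x = - cube J H (fdiff (H i) f) x.
Proof.
move=> iJ; rewrite cubeU1 // /cube -sumrB -sumrN; apply: eq_bigr => S _.
by rewrite /fdiff addrAC; ring.
Qed.

Lemma vanish_cube J H f x : vanish #|J| f -> cube J H f x = 0.
Proof.
move: {-1}#|J| (erefl #|J|) => k; elim: k J f => [|k IH] J f Jk vf.
  rewrite (cards0_eq Jk) /cube (big_pred1 set0) => [|S]; last by rewrite subset0.
  by rewrite [f _]vf mulr0.
have /card_gt0P[i iJ] : (0 < #|J|)%N by rewrite Jk.
rewrite -(setD1K iJ) cube_fdiff ?setD11 // IH ?oppr0 //.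
by move: Jk; rewrite (cardsD1 i) iJ => -[].
Qed.

Lemma cube_vanish J f : (forall H x, cube J H f x = 0) -> vanish #|J| f.
Proof.
move: {-1}#|J| (erefl #|J|) => k; elim: k J f => [|k IH] J f Jk Cf /=.
  move=> x; have := Cf (fun=> 0) x; rewrite (cards0_eq Jk) /cube (big_pred1 set0).
    by rewrite cards0 mul1r big_set0 addr0.
  by move=> S; rewrite subset0.
have /card_gt0P[i iJ] : (0 < #|J|)%N by rewrite Jk.
move=> h; apply: (IH (J :\ i)).
  by move: Jk; rewrite (cardsD1 i) iJ => -[].
move=> H x; have := Cf (fun j => if j == i then h else H j) x.
rewrite -{1}(setD1K iJ) cube_fdiff ?setD11 // eqxx => /eqP; rewrite oppr_eq0 => /eqP <-.
by apply: eq_cube => // j; rewrite !inE => /andP[/negPf -> _].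
Qed.

End Cube.

(** * The parallelepiped test and local correction *)

Section CubeTest.
Variables (R : realFieldType) (V : finZmodType) (K : comNzRingType) (k : nat).
Variable f : V -> K.
Local Notation dirs := {ffun 'I_k -> V}.
Local Notation C := (cube [set: 'I_k]).

Definition cube_test : R := avg (fun z : V * dirs => (C z.2 f z.1 != 0)%:R).

Lemma cubeT_split i (H : dirs) x :
  C H f x = cube [set~ i] H f x - cube [set~ i] H f (x + H i).
Proof.
rewrite -cubeU1 ?setC11 //; congr (cube _ _ _ _).
by apply/setP => j; rewrite !inE orbN.
Qed.

(** Interpolates from [H] to [H'], replacing one direction at a time. *)
Let hyb i (H H' : dirs) : dirs := [ffun j : 'I_k => if (j < i)%N then H' j else H j].

(** Consecutive hybrids differ in direction [i] alone, so their alternating sums differ by the one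
    based at [x + H' i] with [i]-th direction [H i - H' i]; this parallelepiped is uniform although
    [x] is fixed. *)
Lemma cube_test_hybrid x (i : 'I_k) :
  avg (fun z : dirs * dirs =>
         (C (hyb i z.1 z.2) f x != C (hyb i.+1 z.1 z.2) f x)%:R) = cube_test.
Proof.
pose phi (z : dirs * dirs) : V * dirs := (x + z.2 i,
  [ffun j : 'I_k => if (j < i)%N then z.2 j else if j == i then z.1 i - z.2 i else z.1 j]).
(* Adding [u.1] to both [H i] and [H' i] moves the base point and keeps direction [i]; [u.2] moves
   each direction separately. *)
pose act (u : V * dirs) (z : dirs * dirs) : dirs * dirs :=
  ([ffun j : 'I_k => z.1 j + (if (j < i)%N then 0 else if j == i then u.2 i + u.1 else u.2 j)],
   [ffun j : 'I_k => z.2 j + (if (j < i)%N then u.2 j else if j == i then u.1 else 0)]).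
pose F (z : V * dirs) : R := (C z.2 f z.1 != 0)%:R.
rewrite /cube_test -[RHS](@avg_push R _ _ ([ffun=> 0], [ffun=> 0]) act phi).
- apply: eq_avg => -[H H'] /=; congr (~~ _)%:R.
  rewrite -subr_eq0; congr (_ == 0).
  rewrite !(cubeT_split i) !ffunE ltnn ltnSn eqxx.
  have e1 y : cube [set~ i] (hyb i H H') f y = cube [set~ i] [ffun j : 'I_k =>
      if (j < i)%N then H' j else if j == i then H i - H' i else H j] f y.
    by apply: eq_cube => // j; rewrite !inE !ffunE => /negPf ->.
  have e2 y : cube [set~ i] (hyb i.+1 H H') f y = cube [set~ i] [ffun j : 'I_k =>
      if (j < i)%N then H' j else if j == i then H i - H' i else H j] f y.
    apply: eq_cube => // j; rewrite !inE !ffunE => ji.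
    by rewrite (negPf ji) ltnS leq_eqVlt (inj_eq val_inj) (negPf ji).
  have e3 : x + H' i + (H i - H' i) = x + H i by rewrite -addrA [H' i + _]addrC subrK.
  rewrite !e1 !e2 e3; ring.
- move=> [u W] [H H'] [G G'] /= [/ffunP e1 /ffunP e2]; congr (_, _); apply/ffunP => j.
    by have := e1 j; rewrite !ffunE => /addIr.
  by have := e2 j; rewrite !ffunE => /addIr.
- move=> [H H'] [u W] [u' W']; rewrite /phi /= !ffunE !ltnn eqxx.
  case=> /addrI /addrI eu /ffunP e; rewrite eu; congr (_, _); apply/ffunP => j.
  have := e j; rewrite !ffunE.
  case: (j < i)%N => [/addrI|] //; case: eqVneq => [->|_ /addrI] //.
  by rewrite eu => /addIr /addrI /addIr.
Qed.

Lemma neq_chain (T : eqType) (c : nat -> T) m :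
  (c 0 != c m)%:R <= \sum_(i < m) (c i != c i.+1)%:R :> R.
Proof.
elim: m => [|m IH]; first by rewrite eqxx big_ord0.
rewrite big_ord_recr /=; apply: le_trans (lerD IH (lexx _)).
case: (eqVneq (c m) (c m.+1)) => [->|]; first by rewrite addr0.
by move=> _; rewrite -natrD ler_nat; case: (_ != _); case: (_ != _).
Qed.

Lemma cube_test_collision x :
  avg (fun H : dirs => avg (fun H' : dirs => (C H f x != C H' f x)%:R))
    <= k%:R * cube_test.
Proof.
rewrite -(avg_pair (fun z : dirs * dirs => (C z.1 f x != C z.2 f x)%:R)).
have -> : k%:R * cube_test = \sum_(i < k) cube_test.
  by rewrite sumr_const card_ord mulr_natl.
under eq_bigr => i _ do rewrite -(cube_test_hybrid x i).
rewrite -avg_sum; apply: ler_avg => -[H H'] /=.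
have := @neq_chain K (fun i => C (hyb i H H') f x) k.
suff [-> ->] : hyb 0 H H' = H /\ hyb k H H' = H' by [].
by split; apply/ffunP => j; rewrite ffunE ?ltn0 ?ltn_ord.
Qed.

(** [g x] is the value that [f x - C H f x] takes for most directions. On a fixed parallelepiped
    every vertex value of [g] is rewritten through [f] along correlated random directions; a union
    bound gives one choice for which all rewritings hold and all the resulting alternating sums of
    [f] are zero. *)
Lemma cube_test_correction : (0 < k)%N -> (2 ^ k * k.+1)%:R * cube_test < 1 ->
  exists g : V -> K, (forall H x, C H g x = 0) /\
    avg (fun x => (f x != g x)%:R) <= 2 * cube_test.
Proof.
move=> k0 eps_small; set eps := cube_test in eps_small *.
have eps0 : 0 <= eps by apply: avg_ge0 => z; rewrite ler0n.
have key x : exists v, avg (fun H : dirs => (v != f x - C H f x)%:R) <= k%:R * eps.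
  (* Some [H0] disagrees with a random [H'] no more often than the average pair does. *)
  have [H0 H0P] := @exists_le_avg R _ ([ffun=> 0] : dirs)
    (fun H : dirs => avg (fun H' : dirs => (C H f x != C H' f x)%:R)).
  exists (f x - C H0 f x); apply: (le_trans _ (le_trans H0P (cube_test_collision x))).
  by apply: ler_avg => H; rewrite (can_eq (subKr _)).
have [g gP] := choice key; exists g; split; last first.
  (* Directions not yielding [g x] have density at most 1/2, so where [f] and [g] differ, [C H f x]
     is nonzero for at least half of the directions; averaging over [x] gives the factor 2. *)
  have keps : k%:R * eps <= 1 / 2.
    have : (2 * k)%:R * eps <= (2 ^ k * k.+1)%:R * eps.
      rewrite ler_wpM2r // ler_nat leq_mul // -{1}(expn1 2) leq_exp2l //.
    by rewrite natrM; lra.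
  rewrite /eps /cube_test avg_pair -avgZ; apply: ler_avg => x /=.
  have : (f x != g x)%:R <= avg (fun H : dirs => (g x != f x - C H f x)%:R)
       + avg (fun H : dirs => (C H f x != 0)%:R) :> R.
    rewrite -avgD -[leLHS](avg_cst ([ffun=> 0] : dirs)); apply: ler_avg => H.
    case: (eqVneq (C H f x) 0) => [->|_] /=.
      by rewrite subr0 addr0 eq_sym.
    by rewrite -natrD ler_nat; case: (_ != _); case: (_ != _).
  case: (f x != g x) => /=; have := gP x; first lra.
  by move=> _ _; rewrite mulr_ge0 // avg_ge0 // => H; rewrite ler0n.
pose TT := (dirs * {ffun 'I_k -> dirs})%type.
move=> H x.
(* Vertex [S] is corrected along [shift z S]. For fixed [U], the points [pt S] plus the sum of
   [shift z S i] over [i] in [U] are, as [S] varies, the vertices of the parallelepiped with base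
   [base z U] and directions [dir z U]. *)
pose shift (z : TT) (S : {set 'I_k}) : dirs := [ffun i => z.1 i + \sum_(j in S) z.2 j i].
pose base (z : TT) (U : {set 'I_k}) := x + \sum_(i in U) z.1 i.
pose dir (z : TT) (U : {set 'I_k}) : dirs := [ffun j => H j + \sum_(i in U) z.2 j i].
pose pt (S : {set 'I_k}) := x + \sum_(j in S) H j.
pose bad1 (z : TT) (S : {set 'I_k}) : R := (g (pt S) != f (pt S) - C (shift z S) f (pt S))%:R.
pose bad2 (z : TT) (U : {set 'I_k}) : R :=
  ((U != set0) && (C (dir z U) f (base z U) != 0))%:R.
have z0 : TT := ([ffun=> 0], [ffun=> [ffun=> 0]]).
have avg1 S : avg (bad1^~ S) <= k%:R * eps.
  apply: le_trans (gP (pt S)).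
  rewrite -(@avg_push R TT dirs z0 (fun W z => ([ffun i => z.1 i + W i], z.2))
    (fun z => shift z S)) //.
  - move=> W [a b] [a' b'] /= [/ffunP e ->]; congr (_, _); apply/ffunP => i.
    by have := e i; rewrite !ffunE => /addIr.
  - move=> [a b] W W' /ffunP e; apply/ffunP => i.
    by have := e i; rewrite !ffunE => /addIr /addrI.
have avg2 U : avg (bad2^~ U) <= eps.
  have [->|/set0Pn[i0 i0U]] := eqVneq U set0.
    by rewrite /bad2 eqxx /= /avg big1 ?mul0r.
  (* Moving only the entries with index [i0] already makes base and directions uniform; here [U]
     must be nonempty. *)
  rewrite /eps /cube_test -(@avg_push R TT (V * dirs)%type z0 (fun u z =>
      ([ffun i => z.1 i + (if i == i0 then u.1 else 0)],
       [ffun j => [ffun i => z.2 j i + (if i == i0 then u.2 j else 0)]]))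
      (fun z => (base z U, dir z U))).
  - by apply: ler_avg => z; rewrite /bad2 /=; case: (U != set0) => //=; rewrite ler0n.
  - move=> [u W] [a b] [a' b'] /= [/ffunP e1 /ffunP e2]; congr (_, _); apply/ffunP => i.
      by have := e1 i; rewrite !ffunE => /addIr.
    apply/ffunP => j; have /ffunP /(_ j) := e2 i; by rewrite !ffunE => /addIr.
  - have sumE (c : 'I_k -> V) (u : V) : \sum_(i in U) (c i + (if i == i0 then u else 0))
         = \sum_(i in U) c i + u.
      rewrite big_split /=; congr (_ + _); rewrite -big_mkcondr (big_pred1 i0) // => i /=.
      by case: eqP => [->|]; rewrite ?i0U ?andbF.
    move=> [a b] [u W] [u' W']; rewrite /base /dir /=.
    have sE (c : dirs) (w : V) :
        \sum_(i in U) [ffun i1 => c i1 + (if i1 == i0 then w else 0)] i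
         = \sum_(i in U) c i + w.
      by rewrite -sumE; apply: eq_bigr => i _; rewrite ffunE.
    rewrite !sE => -[/addrI /addrI -> /ffunP e]; congr (_, _); apply/ffunP => j.
    by have := e j; rewrite !ffunE !sE => /addrI/addrI.
(* [tot] counts bad events, so a [z] with [tot z < 1] has none; the expected count is at most 2^k (k
   + 1) eps. *)
pose tot (z : TT) := \sum_S bad1 z S + \sum_U bad2 z U.
have [z zP] := exists_le_avg z0 tot.
have tot1 : tot z < 1.
  apply: le_lt_trans zP _; rewrite avgD !avg_sum; apply: (le_lt_trans _ eps_small).
  apply: (@le_trans _ _ (\sum_(S : {set 'I_k}) k%:R * eps + \sum_(S : {set 'I_k}) eps)).
    by apply: lerD; apply: ler_sum => S _.
  rewrite !sumr_const -cardsT -powersetT card_powerset cardsT card_ord.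
  suff -> : k%:R * eps *+ 2 ^ k + eps *+ 2 ^ k = (2 ^ k * k.+1)%:R * eps by [].
  by rewrite natrM -natr1 -[_ * _ *+ _]mulr_natl -[eps *+ _]mulr_natl; move: (2 ^ k)%N => m; ring.
have bad1_0 S : bad1 z S = 0.
  have le : bad1 z S <= tot z.
    rewrite /tot (bigD1 S) //= -addrA lerDl addr_ge0 // sumr_ge0 // => *; by rewrite ler0n.
  by move: (le_lt_trans le tot1); rewrite /bad1; case: (_ != _) => //=; rewrite ltxx.
have bad2_0 S : bad2 z S = 0.
  have le : bad2 z S <= tot z.
    rewrite /tot [X in _ + X](bigD1 S) //= addrCA lerDl addr_ge0 // sumr_ge0 // => *; by rewrite ler0n.
  by move: (le_lt_trans le tot1); rewrite /bad2; case: (_ && _) => //=; rewrite ltxx.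
(* The term of the empty subset in the alternating sum is [f (pt S)] itself and cancels. *)
have gE S : g (pt S) = - \sum_(U : {set 'I_k} | U != set0)
    (-1) ^+ #|U| * f (pt S + \sum_(i in U) shift z S i).
  have /eqP := bad1_0 S; rewrite /bad1 pnatr_eq0 eqb0 negbK => /eqP ->.
  rewrite {1}/cube (bigD1 set0) ?sub0set //= cards0 expr0 mul1r big_set0 addr0 opprD addNKr.
  by congr (- _); apply: eq_bigl => U; rewrite subsetT.
rewrite /cube.
under eq_bigr => S _ do rewrite -/(pt S) gE mulrN mulr_sumr.
(* Summing over [S] first turns each nonempty [U] into one alternating sum of [f], zero by
   [bad2_0]. *)
rewrite sumrN exchange_big /= big1 ?oppr0 // => U U0.
have /eqP := bad2_0 U; rewrite /bad2 U0 /= pnatr_eq0 eqb0 negbK => /eqP CU.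
transitivity ((-1) ^+ #|U| * C (dir z U) f (base z U)); last by rewrite CU mulr0.
rewrite /cube mulr_sumr; apply: eq_bigr => S _; rewrite mulrCA; congr (_ * (_ * f _)).
rewrite /pt /base -!addrA; congr (x + _).
have -> : \sum_(i in U) shift z S i = \sum_(i in U) z.1 i + \sum_(i in U) \sum_(j in S) z.2 j i.
  by rewrite -big_split; apply: eq_bigr => i _; rewrite ffunE.
have -> : \sum_(j in S) dir z U j = \sum_(j in S) H j + \sum_(j in S) \sum_(i in U) z.2 j i.
  by rewrite -big_split; apply: eq_bigr => i _; rewrite ffunE.
by rewrite [\sum_(j in S) \sum_(i in U) _]exchange_big /= addrCA.
Qed.

End CubeTest.

(** * Vanishing differences versus polynomial degree *)

Lemma vanish_iter (V : zmodType) (K : comNzRingType) k m h (f : V -> K) :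
  vanish (k + m) f -> vanish m (iter k (fdiff h) f).
Proof.
elim: k f => [//|k IH] f vf; rewrite iterSr; apply: IH; exact: vf.
Qed.

(** Pascal's rule. The bound [N] does not depend on [c], so that one formula serves all values of a
    coordinate. *)
Lemma newton_forward (V : zmodType) (K : comNzRingType) (f : V -> K) h x c N :
  (c < N)%N ->
  f (x + h *+ c) = \sum_(k < N) 'C(c, k)%:R * iter k (fdiff h) f x.
Proof.
case: N => // N; elim: c f => [|c IH] f cN.
  rewrite mulr0n addr0 big_ord_recl /= bin0 mul1r big1 ?addr0 // => i _.
  by rewrite bin0n mul0r.
rewrite mulrSr addrA -[f _](subrK (f (x + h *+ c))) -/(fdiff h f _).
rewrite [fdiff h f _]IH 1?ltnW // [f _]IH 1?ltnW //.
rewrite big_ord_recr big_ord_recl [RHS]big_ord_recl /= bin_small // mul0r addr0.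
rewrite !bin0 addrCA; congr (_ + _); rewrite -big_split; apply: eq_bigr => i _ /=.
by rewrite -iterS iterSr -mulrDl -natrD addnC /bump /= add1n binS.
Qed.

Section Degree.
Variables (p n : nat).
Hypothesis p_pr : prime p.
Local Notation F := 'F_p.
Local Notation point := 'rV[F]_n.
Implicit Types (f g : point -> F) (x y : point).

Lemma Fp_char : p \in [pchar F].
Proof. exact: pchar_Fp. Qed.

(** A coordinate is affine, hence killed by two differences; the Leibniz rule then handles
    monomials. *)
Lemma deg_le_vanish d f : deg_le d f -> vanish d.+1 f.
Proof.
move=> [C [Cd fE]]; apply: eq_vanish (fun x => esym (fE x)) _.
apply: vanish_sum => e _; have [->|Ce] := eqVneq (C e) 0.
  by apply: vanish0 => x; rewrite mul0r.
apply: vanishZ; apply: (@vanishW _ _ (mdeg e).+1); first by rewrite ltnS Cd.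
apply: vanish_prod => i; elim: (nat_of_ord (e i)) => [|k IH]; first exact: vanish_cst.
have v2 : vanish 2 (fun x : point => x ord0 i).
  by move=> h h' x; rewrite /fdiff !mxE; ring.
by apply: eq_vanish (vanishM v2 IH) => x; rewrite exprS.
Qed.

(** The binomial coefficient X over k as a polynomial, used for [k < p], where k! is invertible mod
    p. *)
Definition bin_poly k : {poly F} :=
  (k`!%:R)^-1 *: \prod_(j < k) ('X - (j%:R)%:P).

Lemma fact_Fp_neq0 k : (k < p)%N -> k`!%:R != 0 :> F.
Proof.
elim: k => [|k IH] kp; first exact: oner_neq0.
rewrite factS natrM mulf_neq0 ?IH 1?ltnW //.
by rewrite -(dvdn_pcharf Fp_char) gtnNdvd.
Qed.

Lemma size_bin_poly k : (k < p)%N -> size (bin_poly k) = k.+1.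
Proof.
move=> kp; rewrite size_scale ?invr_eq0 ?fact_Fp_neq0 //.
by rewrite size_prod_XsubC -[index_enum _]enumT size_enum_ord.
Qed.

Lemma bin_polyE k c : (k < p)%N -> (bin_poly k).[c%:R] = 'C(c, k)%:R.
Proof.
move=> kp; apply: (mulfI (fact_Fp_neq0 kp)).
rewrite hornerZ mulrA divff ?fact_Fp_neq0 // mul1r -natrM mulnC bin_ffact.
rewrite horner_prod ffact_prod natr_prod.
have [ck|kc] := ltnP c k.
  rewrite (bigD1 (Ordinal ck)) //= [RHS](bigD1 (Ordinal ck)) //= !hornerE subrr.
  by rewrite subnn !mul0r.
apply: eq_bigr => j _; rewrite !hornerE natrB //.
exact: leq_trans (ltnW (ltn_ord j)) kc.
Qed.

(* Unlike [deg_le], this class is visibly closed under multiplication by a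
   univariate polynomial in a coordinate outside [s]. *)
Inductive sum_of_products (s : seq 'I_n) (d : nat) : (point -> F) -> Prop :=
| SumNil f : (forall x, f x = 0) -> sum_of_products s d f
| SumAdd f g h : sum_of_products s d f -> sum_of_products s d g ->
    (forall x, h x = f x + g x) -> sum_of_products s d h
| SumProd c (q : 'I_n -> {poly F}) f :
    (forall i, i \notin s -> q i = 1) -> (forall i, (size (q i) <= p)%N) ->
    (\sum_i (size (q i)).-1 <= d)%N ->
    (forall x, f x = c * \prod_i (q i).[x ord0 i]) -> sum_of_products s d f.

Lemma deg_leD d f g h : deg_le d f -> deg_le d g ->
  (forall x, h x = f x + g x) -> deg_le d h.
Proof.
move=> [C [Cd fE]] [C' [Cd' gE]] hE; exists (fun e => C e + C' e); split=> [e|x].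
  have [->|Ce _] := eqVneq (C e) 0; last exact: Cd.
  by rewrite add0r => /Cd'.
by rewrite hE fE gE -big_split; apply: eq_bigr => e _; rewrite mulrDl.
Qed.

(** Expanding each factor into p coefficients and distributing gives monomials; a nonzero
    coefficient forces [e i] below the size of [q i] for every [i]. *)
Lemma sum_of_products_deg_le s d f : sum_of_products s d f -> deg_le d f.
Proof.
elim=> {f} [f f0|f g h _ IHf _ IHg hE|c q f q1 qp qd fE].
- exists (fun=> 0); split=> [e|x]; first by rewrite eqxx.
  by rewrite f0 big1 // => e _; rewrite mul0r.
- exact: deg_leD IHf IHg hE.
exists (fun e : {ffun 'I_n -> 'I_p} => c * \prod_i (q i)`_(e i)); split=> [e|x].
  rewrite mulf_eq0 negb_or => /andP[_ /prodf_neq0 qe].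
  apply: leq_trans qd; apply: leq_sum => i _.
  have := qe i isT; apply: contraNT; rewrite -ltnNge => iq.
  by rewrite nth_default //; move: iq; case: (size (q i)).
rewrite fE.
under eq_bigr => i _ do rewrite (horner_coef_wide _ (qp i)).
rewrite bigA_distr_bigA mulr_sumr; apply: eq_bigr => e _.
by rewrite -mulrA; congr (_ * _); rewrite big_split.
Qed.

Lemma sum_of_productsM s d f i (r : {poly F}) : i \notin s -> (size r <= p)%N ->
    sum_of_products s d f ->
  sum_of_products (i :: s) (d + (size r).-1) (fun x => f x * r.[x ord0 i]).
Proof.
move=> iNs rp; elim=> {f} [f f0|f g h _ IHf _ IHg hE|c q f q1 qp qd fE].
- by apply: SumNil => x; rewrite f0 mul0r.
- by apply: SumAdd IHf IHg _ => x; rewrite hE mulrDl.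
apply: (@SumProd _ _ c (fun j => if j == i then r else q j)).
- move=> j; rewrite inE negb_or => /andP[/negPf -> js]; exact: q1.
- by move=> j; case: eqP.
- rewrite (bigD1 i) //= eqxx addnC leq_add2r; apply: leq_trans qd.
  rewrite [leqRHS](bigD1 i) //= q1 // size_poly1 add0n.
  by apply: leq_sum => j /negPf ->.
- move=> x; rewrite fE -mulrA; congr (_ * _).
  rewrite (bigD1 i) //= [RHS](bigD1 i) //= eqxx q1 // hornerE mul1r mulrC.
  by congr (_ * _); apply: eq_bigr => j /negPf ->.
Qed.

Lemma sum_of_products_sum s d N (G : 'I_N -> point -> F) f :
    (forall k, sum_of_products s d (G k)) ->
    (forall x, f x = \sum_(k < N) G k x) -> sum_of_products s d f.
Proof.
elim: N G f => [|N IH] G f GP fE.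
  by apply: SumNil => x; rewrite fE big_ord0.
apply: (SumAdd (IH (fun k => G (widen_ord (leqnSn N) k)) _ _ (fun=> erefl)) (GP ord_max)) => //.
by move=> x; rewrite fE big_ord_recr.
Qed.

Definition zero_coord (i : 'I_n) x : point :=
  \row_j (if j == i then 0 else x ord0 j).

Lemma iter_fdiff_local (s : seq 'I_n) f h :
    (forall x y, {in s, forall i, x ord0 i = y ord0 i} -> f x = f y) ->
  forall k x y, {in s, forall i, x ord0 i = y ord0 i} ->
  iter k (fdiff h) f x = iter k (fdiff h) f y.
Proof.
move=> fs; elim=> [|k IH] x y xy /=; first exact: fs.
by congr (_ - _); apply: IH => // i js; rewrite !mxE xy.
Qed.

(** Newton expansion in coordinate [i], started where that coordinate is 0: the k-th coefficient is
    a k-fold difference, so it loses k degrees and depends only on the coordinates in [s], while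
    [bin_poly k] contributes degree k. *)
Lemma vanish_sum_of_products s d f : uniq s -> vanish d.+1 f ->
    (forall x y, {in s, forall i, x ord0 i = y ord0 i} -> f x = f y) ->
  sum_of_products s d f.
Proof.
elim: s d f => [|i s IH] d f.
  move=> _ _ f0; apply: (@SumProd _ _ (f 0) (fun=> 1)) => //.
  - by move=> i; rewrite size_poly1 prime_gt0.
  - by rewrite big1 // => i _; rewrite size_poly1.
  - by move=> x; rewrite big1 ?mulr1 => [|i _]; rewrite ?hornerE //; apply: f0.
rewrite cons_uniq => /andP[iNs us] vf fs.
pose ei : point := delta_mx ord0 i.
pose G (k : 'I_p) x := iter k (fdiff ei) f (zero_coord i x) * (bin_poly k).[x ord0 i].
apply: (@sum_of_products_sum _ _ p G) => [k|x]; last first.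
  (* Coordinate [i], read as a natural number below p, counts the steps along [ei]. *)
  have xE : x = zero_coord i x + ei *+ (x ord0 i : nat).
    apply/rowP => j; rewrite mxE mulmxnE !mxE eqxx /=.
    by have [->|_] := eqVneq j i; rewrite ?mul0rn ?addr0 ?add0r // natr_Zp.
  have xp : (x ord0 i < p)%N.
    by rewrite -[leqRHS](Fp_cast p_pr) ltn_ord.
  rewrite {1}xE (newton_forward _ _ _ xp); apply: eq_bigr => k _.
  by rewrite mulrC /G -{2}[x ord0 i]natr_Zp bin_polyE.
have [kd|dk] := leqP k d; last first.
  apply: SumNil => x; rewrite /G.
  have v0 : vanish 0 (iter k (fdiff ei) f).
    by apply: (@vanish_iter _ _ k 0); apply: (vanishW _ vf); rewrite addn0.
  by rewrite v0 mul0r.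
have -> : d = ((d - k) + (size (bin_poly k)).-1)%N.
  by rewrite size_bin_poly //= subnK.
apply: (@sum_of_productsM s (d - k) (fun x => iter k (fdiff ei) f (zero_coord i x))) => //.
  by rewrite size_bin_poly.
apply: IH => //.
  apply: (vanish_comp (psi := zero_coord i)).
    by move=> x h; apply/rowP => j; rewrite !mxE; case: eqP => _; rewrite ?addr0.
  by apply: vanish_iter; rewrite addnS subnKC.
move=> x y xy; apply: (@iter_fdiff_local (i :: s)) => // j; rewrite inE !mxE.
by case: eqP => // _ /xy.
Qed.

Lemma vanish_deg_le d f : vanish d.+1 f -> deg_le d f.
Proof.
move=> vf; apply: (@sum_of_products_deg_le (enum 'I_n)).
apply: vanish_sum_of_products => //; first exact: enum_uniq.
move=> x y xy; congr f; apply/rowP => j; apply: xy; exact: mem_enum.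
Qed.

End Degree.

(** * Density and number of low-degree polynomials *)

(** A nonzero difference [fdiff h f] has one degree less and is nonzero only where [f] is nonzero at
    [x] or at [x + h], so each degree costs a factor 2. *)
Lemma vanish_density (R : realFieldType) (V : finZmodType) (K : comNzRingType)
    k (f : V -> K) : vanish k.+1 f -> (exists x, f x != 0) ->
  (2 ^+ k)^-1 <= avg (fun x => (f x != 0)%:R) :> R.
Proof.
have cst g : vanish 1 g -> (exists x, g x != 0) ->
    avg (fun x : V => (g x != 0 :> K)%:R) = 1 :> R.
  move=> vg [x gx]; rewrite -[RHS](avg_cst (0 : V)); apply: eq_avg => y.
  have := vg (y - x) x; rewrite /fdiff addrCA subrr addr0 => /eqP; rewrite subr_eq0 => /eqP ->.
  by rewrite gx.
elim: k f => [|k IH] f vf fx; first by rewrite expr0 invr1 cst.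
(* If every difference is zero, [f] is a nonzero constant, of density 1. *)
have [[h hP]|noh] := pselect (exists h, exists x, fdiff h f x != 0); last first.
  rewrite cst ?invf_le1 ?exprn_gt0 ?exprn_ege1 ?ler1n //.
  move=> h x; apply/eqP; apply: contrapT => /negP fh; apply: noh; by exists h; exists x.
have le2 : avg (fun x => (fdiff h f x != 0)%:R) <= 2 * avg (fun x => (f x != 0)%:R) :> R.
  have -> : 2 * avg (fun x => (f x != 0)%:R) =
      avg (fun x => (f (x + h) != 0)%:R + (f x != 0)%:R) :> R.
    rewrite avgD (@avg_inj _ _ (fun x => x + h) (fun x => (f x != 0)%:R)); last exact: addIr.
    by rewrite mulr_natl mulr2n.
  apply: ler_avg => x; rewrite -natrD ler_nat /fdiff.
  by case: (eqVneq (f (x + h)) 0) => [->|_]; case: (eqVneq (f x) 0) => [->|_];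
    rewrite ?subrr ?eqxx //=; case: (_ != _).
rewrite exprS invfM ler_pdivrMl ?ltr0n //.
exact: le_trans (IH _ (vf h) hP) le2.
Qed.

Section VanishingPolynomials.
Variables (p m d : nat).
Hypothesis p_pr : prime p.
Local Notation F := 'F_p.

Definition vpoly : {set {ffun 'rV[F]_m -> F}} := [set G : {ffun 'rV[F]_m -> F} | `[< vanish d.+1 G >]].

Lemma vpolyP (G : {ffun 'rV[F]_m -> F}) : reflect (vanish d.+1 G) (G \in vpoly).
Proof. by rewrite inE; apply: asboolP. Qed.

Lemma vpoly0 : [ffun=> 0] \in vpoly.
Proof. by apply/vpolyP/vanish0 => x; rewrite ffunE. Qed.

Lemma vpolyB (G G' : {ffun 'rV[F]_m -> F}) : G \in vpoly -> G' \in vpoly ->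
  [ffun x => G x - G' x] \in vpoly.
Proof.
move=> /vpolyP vG /vpolyP /(vanishZ (-1)) vG'; apply/vpolyP.
by apply: eq_vanish (vanishD vG vG') => x; rewrite ffunE mulN1r.
Qed.

Definition low_exponents : {set {ffun 'I_m -> 'I_p}} := [set e | (mdeg e <= d)%N].

Lemma card_vpoly : (#|vpoly| <= p ^ #|low_exponents|)%N.
Proof.
pose E := {ffun {ffun 'I_m -> 'I_p} -> F}.
pose ev (C : E) : {ffun 'rV[F]_m -> F} := [ffun x => \sum_e C e * monomial e x].
pose D := [set C : E | C \in pffun_on 0 (mem low_exponents) (predT : pred F)].
have -> : (p ^ #|low_exponents|)%N = #|D|.
  have := card_pffun_on (0 : F) (mem low_exponents) (predT : pred F).
  rewrite cardT -cardE card_Fp // => cE; transitivity (p ^ #|mem low_exponents|)%N; first by [].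
  by rewrite -cE; apply: eq_card => C; rewrite [in RHS]inE.
apply: (leq_trans _ (leq_imset_card ev (mem D))); apply: subset_leq_card.
apply/subsetP => G /vpolyP/(vanish_deg_le p_pr)[C [Cd GE]].
apply/imsetP; exists (finfun C); last first.
  by apply/ffunP => x; rewrite ffunE GE; apply: eq_bigr => e _; rewrite ffunE.
rewrite !inE; apply/pffun_onP; split=> [|y _]; last by [].
by apply/subsetP => e; rewrite !inE ffunE => /Cd.
Qed.

(* Markov's inequality for the weight [z ^+ mdeg e]. *)
Lemma card_low_exponents (R : realFieldType) (z : R) : 0 < z -> z < 1 ->
  #|low_exponents|%:R * z ^+ d * (1 - z) ^+ m <= 1.
Proof.
move=> z0 z1.
have sum_le : #|low_exponents|%:R * z ^+ d <= \sum_(e : {ffun 'I_m -> 'I_p}) z ^+ mdeg e.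
  rewrite mulr_natl -sumr_const [leRHS](bigID (mem low_exponents)) /=.
  rewrite -[leLHS]addr0 lerD ?sumr_ge0 // => [|e _]; last by rewrite exprn_ge0 ?ltW.
  apply: ler_sum => e; rewrite inE => ed.
  by rewrite ler_wiXn2l // ltW.
apply: (@le_trans _ _ ((\sum_(e : {ffun 'I_m -> 'I_p}) z ^+ mdeg e) * (1 - z) ^+ m)).
  by rewrite ler_wpM2r // exprn_ge0 // subr_ge0 ltW.
have -> : \sum_(e : {ffun 'I_m -> 'I_p}) z ^+ mdeg e = (\sum_(j < p) z ^+ j) ^+ m.
  have -> : (\sum_(j < p) z ^+ j) ^+ m = \prod_(i < m) \sum_(j < p) z ^+ j.
    by rewrite prodr_const card_ord.
  rewrite bigA_distr_bigA.
  by apply: eq_bigr => e _; rewrite prodrXr.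
rewrite -exprMn exprn_ile1 //.
  by rewrite mulr_ge0 ?subr_ge0 ?(ltW z1) ?sumr_ge0 // => j _; rewrite exprn_ge0 ?ltW.
rewrite mulrC -[1 - z]opprB mulNr -subrX1 opprB gerBl exprn_ge0 ?ltW //.
Qed.

End VanishingPolynomials.

(** * Rejection probability of one block *)

Section BlockTest.
Variables (R : realFieldType) (p m d : nat).
Hypothesis p_pr : prime p.
Local Notation F := 'F_p.
Local Notation vpoly := (vpoly p m d).
Implicit Types (G : {ffun 'rV[F]_m -> F}) (f : 'rV[F]_m -> F).

Definition nearest f : {ffun 'rV[F]_m -> F} :=
  [arg min_(G < [ffun=> 0] in vpoly) #|[pred y | f y != G y]|].

Definition vdist f : R := avg (fun y => (f y != nearest f y)%:R).

Lemma nearest_vpoly f : nearest f \in vpoly.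
Proof. by rewrite /nearest; case: arg_minnP => //; apply: vpoly0. Qed.

Lemma vdist_le f G : G \in vpoly -> vdist f <= avg (fun y => (f y != G y)%:R).
Proof.
move=> GP; rewrite /vdist !avg_indicator ler_wpM2r ?invr_ge0 ?ler0n // ler_nat.
rewrite /nearest; case: arg_minnP => [|N _ /(_ G GP)]; first exact: vpoly0.
by [].
Qed.

Lemma vdist_le1 f : vdist f <= 1.
Proof. exact: avg_indicator_le1. Qed.

Lemma vdist_ge0 f : 0 <= vdist f.
Proof. by apply: avg_ge0 => y; rewrite ler0n. Qed.

Definition consistent s f (Y : {ffun 'I_s -> 'rV[F]_m}) : bool :=
  [exists G in vpoly, [forall j, G (Y j) == f (Y j)]].

(** Union bound over the nonzero polynomials: each has zeros of density at most 1 - 2^-d, and the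
    [s] points are independent. *)
Lemma interpolating_points s :
    #|vpoly|%:R * (1 - (2 ^+ d)^-1) ^+ s <= 1 / 2 :> R ->
  avg (fun Y : {ffun 'I_s.+1 -> 'rV[F]_m} =>
    [exists G in vpoly, (G != [ffun=> 0]) &&
       [forall j, (j != ord_max) ==> (G (Y j) == 0)]]%:R) <= 1 / 2 :> R.
Proof.
apply: le_trans.
(* Weight 1 leaves the last point unconstrained while the product still runs over all [s.+1]
   indices. *)
pose W (G : {ffun 'rV[F]_m -> F}) (j : 'I_s.+1) (y : 'rV[F]_m) : R :=
  if j == ord_max then 1 else (G y == 0)%:R.
pose good := [set G in vpoly | G != [ffun=> 0]].
apply: (@le_trans _ _ (avg (fun Y : {ffun 'I_s.+1 -> 'rV[F]_m} =>
    \sum_G (G \in good)%:R * \prod_j W G j (Y j)))).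
  apply: ler_avg => Y; case: existsP => [[G /and3P[GP G0 /forallP GY]]|_]; last first.
    rewrite sumr_ge0 // => G _; rewrite mulr_ge0 ?ler0n // prodr_ge0 // => j _.
    by rewrite /W; case: ifP.
  rewrite (bigD1 G) //= inE GP G0 mul1r big1 ?lerDl ?sumr_ge0 // => [G' _|j _].
    rewrite mulr_ge0 ?ler0n // prodr_ge0 // => j _; by rewrite /W; case: ifP.
  by rewrite /W; have := GY j; case: eqP => //= _ ->.
rewrite avg_sum.
apply: (@le_trans _ _ (\sum_(G in good) (1 - (2 ^+ d)^-1) ^+ s)).
  rewrite [leRHS]big_mkcond /=; apply: ler_sum => G _.
  rewrite avgZ; case: ifP => Ggood; rewrite ?mul0r // mul1r avg_ffun_prod.
  rewrite (bigD1 ord_max) //= [W G ord_max]/W eqxx (avg_cst (0 : 'rV[F]_m)) mul1r.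
  have -> : \prod_(j < s.+1 | j != ord_max) avg (W G j) =
      \prod_(j < s.+1 | j != ord_max) avg (fun y => (G y == 0)%:R).
    by apply: eq_bigr => j /negPf jm; apply: eq_avg => y; rewrite /W jm.
  rewrite prodr_const.
  have -> : #|[pred j | j != ord_max :> 'I_s.+1]| = s.
    have := cardC1 (ord_max : 'I_s.+1); rewrite card_ord /= => cE.
    by rewrite -[RHS]cE; apply: eq_card => j; rewrite !inE.
  move: Ggood; rewrite inE => /andP[/vpolyP vG G0].
  have nz : exists x, G x != 0.
    apply: contrapT => /forallNP Gz; case/eqP: G0; apply/ffunP => x; rewrite ffunE.
    by apply/eqP; apply: contrapT => /negP; apply: Gz.
  have le1 : avg (fun y => (G y == 0)%:R) <= 1 - (2 ^+ d)^-1 :> R.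
    have := @vanish_density R _ _ _ _ vG nz.
    have : avg (fun y => (G y == 0)%:R + (G y != 0)%:R) = 1 :> R.
      rewrite -[RHS](avg_cst (0 : 'rV[F]_m)); apply: eq_avg => y.
      by case: (_ == _); rewrite /= ?addr0 ?add0r.
    rewrite avgD; lra.
  have ge0 : 0 <= avg (fun y => (G y == 0)%:R) :> R by apply: avg_ge0 => y; rewrite ler0n.
  by apply: lerXn2r; rewrite ?nnegrE // (le_trans ge0).
rewrite sumr_const -[leLHS]mulr_natl; apply: ler_wpM2r; last rewrite ler_nat.
  rewrite exprn_ge0 // subr_ge0 invf_le1 ?exprn_gt0 ?exprn_ege1 ?ler1n //.
by apply: subset_leq_card; apply/subsetP => G; rewrite inE => /andP[].
Qed.

(** With probability at least 1/2 the first [s] points leave at most one candidate polynomial; the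
    independent last point then refutes it with probability at least [vdist f]. *)
Lemma block_reject s f :
    #|vpoly|%:R * (1 - (2 ^+ d)^-1) ^+ s <= 1 / 2 :> R ->
  vdist f / 2 <= avg (fun Y : {ffun 'I_s.+1 -> 'rV[F]_m} => (~~ consistent f Y)%:R).
Proof.
move=> /interpolating_points; set bad := (X in avg X <= _) => bad_le.
have v0 := vdist_ge0 f.
apply: (@le_trans _ _ (vdist f * avg (fun Y => 1 - bad Y))).
  rewrite avgD (avg_cst [ffun=> 0]).
  have -> : avg (fun Y => - bad Y) = - avg bad.
    by rewrite -mulN1r -avgZ; apply: eq_avg => Y; rewrite mulN1r.
  by apply: ler_wpM2l => //; lra.
rewrite -avgZ (avg_ffun_upd ord_max (fun Y => (~~ _)%:R)); apply: ler_avg => Y.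
rewrite /bad; case: existsP => [_|noG] /=; first by rewrite subrr mulr0 avg_ge0 // => y; rewrite ler0n.
rewrite subr0 mulr1.
pose agree G := [forall j, (j != ord_max) ==> (G (Y j) == f (Y j))].
have updE (y : 'rV[F]_m) j : j != ord_max -> ffun_upd Y ord_max y j = Y j.
  by rewrite ffunE => /negPf ->.
have agreeP y G : (forall j, G (ffun_upd Y ord_max y j) == f (ffun_upd Y ord_max y j)) ->
    G \in vpoly -> agree G.
  by move=> Gf GP; apply/forallP => j; apply/implyP => jm; have := Gf j; rewrite updE.
(* If no polynomial fits the first [s] answers, the block rejects whatever the last point is. *)
have [[G0 G0P G0a]|noG0] := pselect (exists2 G, G \in vpoly & agree G); last first.
  apply: le_trans (vdist_le1 f) _; rewrite -{1}[1](avg_cst (0 : 'rV[F]_m)).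
  apply: ler_avg => y.
  case: (boolP (consistent _ _)) => // /existsP[G /andP[GP /forallP Gf]].
  by case: noG0; exists G => //; apply: agreeP Gf GP.
apply: le_trans (vdist_le f G0P) _; apply: ler_avg => y.
case: eqVneq => [_|fG0] /=; first by rewrite ler0n.
case: (boolP (consistent _ _)) => // /existsP[G /andP[GP /forallP Gf]].
have Ga := agreeP _ _ Gf GP.
(* A second candidate [G], correct at the last point where [G0] fails, makes [G - G0] a nonzero
   polynomial vanishing at the first [s] points. *)
case: noG; exists [ffun x => G x - G0 x]; rewrite vpolyB //=.
apply/andP; split; last first.
  apply/forallP => j; apply/implyP => jm; rewrite ffunE.
  have /forallP/(_ j) := Ga; have /forallP/(_ j) := G0a; rewrite jm /= => /eqP -> /eqP ->.
  by rewrite subrr.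
apply/eqP => /ffunP /(_ y); rewrite !ffunE => /eqP; rewrite subr_eq0 => /eqP GG0.
by case/eqP: fG0; have := Gf ord_max; rewrite ffunE eqxx GG0 => /eqP.
Qed.

End BlockTest.

(** * Restriction to a random affine subspace *)

Section RandomSubspace.
Variables (R : realFieldType) (p m n d : nat).
Hypothesis p_pr : prime p.
Hypothesis dm : (d < m)%N.
Local Notation F := 'F_p.
Local Notation affine := ({ffun 'I_m -> 'rV[F]_n} * 'rV[F]_n)%type.
Variable f : 'rV[F]_n -> F.
Implicit Type a : affine.

Definition lin (M : 'I_m -> 'rV[F]_n) (y : 'rV[F]_m) : 'rV[F]_n :=
  \sum_j y ord0 j *: M j.

(** The directions [a.1] may be dependent, so [a] can be drawn uniformly; degenerate maps are
    accounted for in [avg_lin_eq0]. *)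
Definition aff a (y : 'rV[F]_m) : 'rV[F]_n := a.2 + lin a.1 y.

Lemma linD M y h : lin M (y + h) = lin M y + lin M h.
Proof. by rewrite -big_split; apply: eq_bigr => j _; rewrite mxE scalerDl. Qed.

Lemma affD a y h : aff a (y + h) = aff a y + lin a.1 h.
Proof. by rewrite /aff linD addrA. Qed.

Lemma lin_delta M j : lin M (delta_mx ord0 j) = M j.
Proof.
rewrite /lin (bigD1 j) //= mxE !eqxx scale1r big1 ?addr0 // => i ij.
by rewrite mxE (negPf ij) andbF scale0r.
Qed.

Let emb (j : 'I_d.+1) : 'I_m := widen_ord dm j.
Let unit_dir (j : 'I_d.+1) : 'rV[F]_m := delta_mx ord0 (emb j).

Lemma cube_aff a y :
  cube [set: 'I_d.+1] unit_dir (fun z => f (aff a z)) y =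
  cube [set: 'I_d.+1] (fun j => a.1 (emb j)) f (aff a y).
Proof.
apply: eq_bigr => S _; congr (_ * f _); rewrite affD; congr (_ + _).
elim/big_rec2: _ => [|j _ s _ <-]; last by rewrite linD lin_delta.
by rewrite /lin big1 // => j _; rewrite mxE scale0r.
Qed.

(** For fixed [y], the image of [y] together with the first [d.+1] directions is a uniform
    parallelepiped. *)
Lemma avg_cube_aff y :
  avg (fun a => (cube [set: 'I_d.+1] unit_dir (fun z => f (aff a z)) y != 0)%:R)
  = cube_test R d.+1 f.
Proof.
pose ext (W : {ffun 'I_d.+1 -> 'rV[F]_n}) (i : 'I_m) : 'rV[F]_n :=
  if insub (val i) is Some j then W j else 0.
(* Subtracting [lin (ext u.2) y] compensates the change of directions, so the image of [y] moves by
   exactly [u.1]. *)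
pose act (u : 'rV[F]_n * {ffun 'I_d.+1 -> 'rV[F]_n}) a : affine :=
  ([ffun i => a.1 i + ext u.2 i], a.2 + u.1 - lin (ext u.2) y).
pose phi a := (aff a y, [ffun j => a.1 (emb j)]).
have actE u a : aff (act u a) y = aff a y + u.1.
  rewrite /aff /=.
  have -> : lin [ffun i => a.1 i + ext u.2 i] y = lin a.1 y + lin (ext u.2) y.
    by rewrite -big_split; apply: eq_bigr => i _; rewrite ffunE scalerDr.
  by rewrite addrCA subrK addrC [a.2 + _]addrC -addrA addrC.
rewrite /cube_test -(@avg_push R _ _ ([ffun=> 0], 0) act phi).
- apply: eq_avg => a; rewrite cube_aff; congr (_ != 0)%:R.
  by apply: eq_cube => // j _; rewrite ffunE.
- move=> u [M b] [M' b'] /= [/ffunP e1 /addIr /addIr ->]; congr (_, _).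
  by apply/ffunP => j; have := e1 j; rewrite !ffunE => /addIr.
- move=> a [u W] [u' W']; rewrite /phi !actE /= => -[/addrI -> /ffunP e].
  congr (_, _); apply/ffunP => j; have := e j; rewrite !ffunE => /addrI.
  by rewrite /ext /= valK.
Qed.

(** The nearest polynomial has alternating sum 0, so a nonzero one for [g] needs a disagreement at
    one of the 2^(d+1) vertices, each of which is uniform in [y]. *)
Lemma avg_vdist_aff :
  cube_test R d.+1 f <=
    2 ^+ d.+1 * avg (fun a => vdist R d (fun z => f (aff a z))).
Proof.
rewrite -{1}[cube_test _ _ _](avg_cst (0 : 'rV[F]_m)).
have -> : avg (fun _ : 'rV[F]_m => cube_test R d.+1 f) = avg (fun y => avg (fun a =>
    (cube [set: 'I_d.+1] unit_dir (fun z => f (aff a z)) y != 0)%:R)).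
  by apply: eq_avg => y; rewrite avg_cube_aff.
rewrite avg_exchange -avgZ; apply: ler_avg => a; set g := fun z => f (aff a z).
pose N := nearest d g.
have cN y : cube [set: 'I_d.+1] unit_dir N y = 0.
  by apply: vanish_cube; rewrite cardsT card_ord; apply/vpolyP/nearest_vpoly.
pose sh (S : {set 'I_d.+1}) := \sum_(j in S) unit_dir j.
apply: (@le_trans _ _ (avg (fun y => \sum_(S : {set 'I_d.+1}) (g (y + sh S) != N (y + sh S))%:R))).
  apply: ler_avg => y.
  case: eqVneq => [_|gy] /=; first by rewrite sumr_ge0 // => S _; rewrite ler0n.
  have [[S gS]|noS] := pselect (exists S, g (y + sh S) != N (y + sh S)).
    by rewrite (bigD1 S) //= gS lerDl sumr_ge0 // => S' _; rewrite ler0n.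
  case/eqP: gy; rewrite -(cN y); apply: eq_bigr => S _; congr (_ * _).
  by apply/eqP; apply: contrapT => /negP gS; apply: noS; exists S.
rewrite avg_sum (eq_bigr (fun=> vdist R d g)) => [|S _]; last first.
  by rewrite (@avg_inj R _ (fun y => y + sh S) (fun y => (g y != N y)%:R)) //; apply: addIr.
rewrite sumr_const -cardsT -powersetT card_powerset cardsT card_ord.
by rewrite -[_ *+ _]mulr_natl natrX.
Qed.

(** If K eps is at least 1, the bound follows from [delta <= 1]; otherwise the corrected function
    has degree at most d and is 2 eps-close to [f]. *)
Lemma cube_test_ge (delta : R) : delta <= 1 -> 0 <= delta ->
    (forall g, deg_le d g -> delta <= avg (fun x => (f x != g x)%:R)) ->
  delta <= (2 ^ d.+1 * d.+2)%:R * cube_test R d.+1 f.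
Proof.
move=> d1 d0 far; set K := (2 ^ _ * _)%N; set eps := cube_test _ _ _.
have [K1|K1] := ltP (K%:R * eps) 1; last exact: le_trans d1 K1.
have [g [gC gd]] := cube_test_correction (ltn0Sn d) K1.
have vg : vanish d.+1 g.
  rewrite -[d.+1]card_ord -cardsT; apply: cube_vanish => H x.
  by rewrite -(gC (finfun H) x); apply: eq_cube => // j _; rewrite ffunE.
apply: le_trans (far g (vanish_deg_le p_pr vg)) (le_trans gd _).
rewrite ler_wpM2r //; first by apply: avg_ge0 => z; rewrite ler0n.
rewrite ler_nat (@leq_trans (2 ^ 1 * 1)) // leq_mul // leq_exp2l //.
Qed.

End RandomSubspace.

(** * Probability of hitting a given set of points *)

Section Collisions.
Variables (R : realFieldType) (p m n : nat).
Hypothesis p_pr : prime p.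
Local Notation F := 'F_p.
Local Notation affine := ({ffun 'I_m -> 'rV[F]_n} * 'rV[F]_n)%type.

Lemma avg_point k (x : 'rV[F]_k) : avg (fun y => (y == x)%:R) = (p%:R ^+ k)^-1 :> R.
Proof.
by rewrite avg_indicator card1 div1r card_mx card_Fp // mul1n natrX.
Qed.

(** A nonzero [v] has a uniform image under a random linear map, whence p^-n; the term p^-m is the
    chance that [v] is 0. *)
Lemma avg_lin_eq0 : avg (fun a : affine => avg (fun v => (lin a.1 v == 0)%:R))
  <= (p%:R ^+ m)^-1 + (p%:R ^+ n)^-1 :> R.
Proof.
rewrite avg_exchange -(avg_point (0 : 'rV[F]_m)).
rewrite -[X in _ + X](avg_cst (0 : 'rV[F]_m)) -avgD; apply: ler_avg => v.
have [->|/eqP/rowP v0] := eqVneq v 0.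
  by rewrite (le_trans (avg_indicator_le1 _ _)) // lerDl invr_ge0 exprn_ge0 ?ler0n.
have [i0 vi0] : exists i, v ord0 i != 0.
  apply: contrapT => /forallNP vz; apply: v0 => i; rewrite mxE.
  by apply/eqP; apply: contrapT => /negP; apply: vz.
rewrite add0r -(avg_point (0 : 'rV[F]_n)).
pose act (u : 'rV[F]_n) (a : affine) : affine :=
  ([ffun i => a.1 i + (if i == i0 then (v ord0 i0)^-1 *: u else 0)], a.2).
rewrite -(@avg_push R _ _ ([ffun=> 0], 0) act (fun a : affine => lin a.1 v)) //.
  move=> u [M b] [M' b'] /= [/ffunP e ->]; congr (_, _).
  by apply/ffunP => i; have := e i; rewrite !ffunE => /addIr.
have actE u a : lin (act u a).1 v = lin a.1 v + u.
  rewrite /lin (eq_bigr (fun i => v ord0 i *: a.1 i + (if i == i0 then u else 0))).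
    by rewrite big_split /= -big_mkcond big_pred1_eq.
  by move=> i _; rewrite ffunE scalerDr; case: eqP => [->|_];
    rewrite ?scaler0 // scalerA divff // scale1r.
by move=> a u u'; rewrite !actE => /addrI.
Qed.

(** The fibre over each point of [E] is empty or a coset of the kernel. *)
Lemma avg_aff_mem (a : affine) (E : {set 'rV[F]_n}) :
  avg (fun y => (aff a y \in E)%:R) <= #|E|%:R * avg (fun v => (lin a.1 v == 0)%:R) :> R.
Proof.
apply: (@le_trans _ _ (avg (fun y => \sum_x ((x \in E) && (aff a y == x))%:R))).
  apply: ler_avg => y; case: (boolP (aff a y \in E)) => yE /=; last first.
    by rewrite sumr_ge0 // => x _; rewrite ler0n.
  by rewrite (bigD1 (aff a y)) //= yE eqxx lerDl sumr_ge0 // => x _; rewrite ler0n.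
rewrite avg_sum mulr_natl -sumr_const [leRHS]big_mkcond /=; apply: ler_sum => x _.
case: ifP => xE /=; last by rewrite /avg big1 ?mul0r.
have [[y0 y0x]|noy] := pselect (exists y, aff a y = x); last first.
  apply: (@le_trans _ _ 0); last by apply: avg_ge0 => v; rewrite ler0n.
  rewrite /avg big1 ?mul0r // => y _; case: eqP => // yx; case: noy; by exists y.
rewrite -(@avg_inj R _ (fun v => y0 + v) (fun y => (aff a y == x)%:R)); last exact: addrI.
by apply: ler_avg => v; rewrite affD y0x -[X in _ == X]addr0 (inj_eq (addrI x)).
Qed.

End Collisions.

(** * The tester against an online adversary *)

Section Tester.
Variables (R : realType) (p n d m s L : nat).
Hypothesis p_pr : prime p.
Hypothesis dm : (d < m)%N.
Local Notation F := 'F_p.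
Local Notation affine := ({ffun 'I_m -> 'rV[F]_n} * 'rV[F]_n)%type.
Local Notation block := (affine * {ffun 'I_s.+1 -> 'rV[F]_m})%type.
Local Notation coins := {ffun 'I_L.+1 -> block}.
Implicit Types (o : coins) (adv : seq (point p n) -> {set point p n}).

Definition query o (i : nat) : point p n :=
  let b := o (inord (i %/ s.+1)) in aff b.1 (b.2 (inord (i %% s.+1))).

(** Erased or missing answers impose no condition, which gives perfect completeness. *)
Definition decide o (ans : seq (answer p)) : bool :=
  [forall r : 'I_L.+1, [exists G in vpoly p m d, [forall j : 'I_s.+1,
     if nth None ans (r * s.+1 + j) is Some v then G ((o r).2 j) == v else true]]].

(** As the queries are nonadaptive, the erasures preceding query [i] are a function of the coins
    behind the earlier queries. *)
Definition erased adv o i : {set point p n} :=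
  \bigcup_(j < i) adv (map (query o) (iota 0 j.+1)).

Lemma queryE o (r : 'I_L.+1) (j : 'I_s.+1) :
  query o (r * s.+1 + j) = aff (o r).1 ((o r).2 j).
Proof.
rewrite /query divnMDl // divn_small // addn0 modnMDl modn_small //.
by rewrite !inord_val.
Qed.

Lemma run_answersE o f adv q :
  run_answers q f (fun ans => query o (size ans)) adv =
  [seq if query o i \in erased adv o i then None else Some (f (query o i)) | i <- iota 0 q].
Proof.
rewrite /run_answers; suff -> : iter q (step f (fun ans => query o (size ans)) adv) ([::], [::], set0)
  = (map (query o) (iota 0 q),
     [seq if query o i \in erased adv o i then None else Some (f (query o i)) | i <- iota 0 q],
     erased adv o q) by [].
have iotaS k : iota 0 k.+1 = rcons (iota 0 k) k by rewrite -addn1 iotaD add0n cats1.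
elim: q => [|q IH]; first by rewrite /erased big_ord0.
rewrite iterS IH /step size_map size_iota iotaS !map_rcons.
by congr (_, _, _); rewrite /erased big_ord_recr iotaS map_rcons.
Qed.

Lemma card_erased adv o i t : valid_adversary t adv -> (#|erased adv o i| <= i * t)%N.
Proof.
move=> vadv; rewrite /erased; elim: i => [|i IH]; first by rewrite big_ord0 cards0.
rewrite big_ord_recr /= mulSn addnC.
by apply: leq_trans (leq_card_setU _ _) (leq_add IH (vadv _)).
Qed.

(** Resample the block containing query [i], then the point of that query alone: earlier queries,
    hence the erased set, do not depend on this point, and [avg_aff_mem] applies with at most
    [i * t] erased points. *)
Lemma query_erased_prob adv t (i : nat) : valid_adversary t adv ->
    (i < L.+1 * s.+1)%N ->
  avg (fun o => (query o i \in erased adv o i)%:R)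
    <= (i * t)%:R * ((p%:R ^+ m)^-1 + (p%:R ^+ n)^-1) :> R.
Proof.
move=> vadv iN.
have rL : (i %/ s.+1 < L.+1)%N by rewrite ltn_divLR.
pose r : 'I_L.+1 := inord (i %/ s.+1); pose j : 'I_s.+1 := inord (i %% s.+1).
rewrite (avg_ffun_upd r) -[leRHS](avg_cst ([ffun=> (([ffun=> 0], 0), [ffun=> 0])] : coins)).
apply: ler_avg => o; rewrite avg_pair.
apply: le_trans (ler_wpM2l (ler0n _ _) (avg_lin_eq0 R m n p_pr)).
rewrite -avgZ; apply: ler_avg => a; rewrite (avg_ffun_upd j).
rewrite -[leRHS](avg_cst ([ffun=> 0] : {ffun 'I_s.+1 -> 'rV[F]_m})); apply: ler_avg => Y.
pose o' y : coins := ffun_upd o r (a, ffun_upd Y j y).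
have qi y : query (o' y) i = aff a y by rewrite /query !ffunE eqxx /= ffunE eqxx.
(* An earlier query in the same block uses another entry of [Y]: equal quotient and remainder by
   [s.+1] would force [k = i]. *)
have qk y k : (k < i)%N -> query (o' y) k = query (o' 0) k.
  move=> ki; rewrite /query !ffunE; case: eqP => // kr /=; congr (aff a _); rewrite !ffunE.
  case: eqP => // kj; exfalso.
  have kL : (k %/ s.+1 < L.+1)%N by apply: leq_ltn_trans rL; apply/leq_div2r/ltnW.
  have e1 : (k %/ s.+1 = i %/ s.+1)%N.
    by have /(congr1 val) := kr; rewrite /= !inordK.
  have e2 : (k %% s.+1 = i %% s.+1)%N.
    by have /(congr1 val) := kj; rewrite /= !inordK // ltn_mod.
  by move: ki; rewrite (divn_eq k s.+1) (divn_eq i s.+1) e1 e2 ltnn.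
have eE y : erased adv (o' y) i = erased adv (o' 0) i.
  apply: eq_bigr => k _; congr adv; apply/eq_in_map => l; rewrite mem_iota add0n => /= lk.
  by apply: qk; apply: leq_ltn_trans (ltn_ord k).
apply: (@le_trans _ _ (avg (fun y => (aff a y \in erased adv (o' 0) i)%:R))).
  by apply: ler_avg => y; rewrite -/(o' y) qi eE.
apply: le_trans (avg_aff_mem R a _) _; apply: ler_wpM2r.
  by apply: avg_ge0 => v; rewrite ler0n.
by rewrite ler_nat; apply: card_erased.
Qed.

Variable f : point p n -> F.

(** Composing [f] with an affine map does not raise its degree, so the restriction itself witnesses
    consistency. *)
Lemma decide_complete o adv q : deg_le d f ->
  decide o (run_answers q f (fun ans => query o (size ans)) adv).
Proof.
move=> /deg_le_vanish vf; apply/forallP => r; apply/existsP.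
exists [ffun y => f (aff (o r).1 y)]; apply/andP; split.
  apply/vpolyP; apply: (@eq_vanish _ _ _ (fun y => f (aff (o r).1 y))).
    by move=> y; rewrite ffunE.
  exact: (vanish_comp (affD (o r).1) vf).
apply/forallP => j; rewrite run_answersE.
have [iq|iq] := ltnP (r * s.+1 + j) q; last first.
  by rewrite nth_default // size_map size_iota.
rewrite (nth_map 0%N) ?size_iota // nth_iota // add0n.
by case: ifP => // _; rewrite ffunE queryE.
Qed.

Lemma decide_sound o adv (q := (L.+1 * s.+1)%N) :
    decide o (run_answers q f (fun ans => query o (size ans)) adv) ->
    (forall i, (i < q)%N -> query o i \notin erased adv o i) ->
  [forall r, consistent d (fun y => f (aff (o r).1 y)) (o r).2].
Proof.
move=> /forallP dec noer; apply/forallP => r; have /existsP[G /andP[GP /forallP Gj]] := dec r.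
apply/existsP; exists G; rewrite GP /=; apply/forallP => j; have := Gj j.
have iq : (r * s.+1 + j < q)%N.
  apply: (@leq_trans (r.+1 * s.+1)); last by rewrite leq_mul2r /= ltn_ord.
  by rewrite mulSn addnC ltn_add2r ltn_ord.
rewrite run_answersE (nth_map 0%N) ?size_iota // nth_iota // add0n (negPf (noer _ iq)).
by rewrite queryE.
Qed.

(** Acceptance needs every block consistent or some query erased. Blocks are independent; the
    denominator collects 2^(d+1) (d+2) from [cube_test_ge], 2^(d+1) from [avg_vdist_aff] and 2 from
    [block_reject]. *)
Lemma accept_le (delta : R) adv t (q := (L.+1 * s.+1)%N) :
    0 <= delta -> delta <= 1 -> far_from_deg delta d f -> valid_adversary t adv ->
    #|vpoly p m d|%:R * (1 - (2 ^+ d)^-1) ^+ s <= 1 / 2 :> R ->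
  avg (fun o => (decide o (run_answers q f (fun ans => query o (size ans)) adv))%:R)
    <= (1 - delta / (2 ^ d.+1 * d.+2 * 2 ^ d.+2)%:R) ^+ L.+1
       + (q * q * t)%:R * ((p%:R ^+ m)^-1 + (p%:R ^+ n)^-1).
Proof.
move=> d0 d1 far vadv interp.
pose cons (b : block) := consistent d (fun y => f (aff b.1 y)) b.2.
pose tot o : R := \prod_r (cons (o r))%:R
   + \sum_(i < q) (query o i \in erased adv o i)%:R.
apply: (@le_trans _ _ (avg tot)).
  apply: ler_avg => o.
  case dec: (decide _ _); last first.
    rewrite addr_ge0 ?prodr_ge0 ?sumr_ge0 // => *; by rewrite ler0n.
  have [[i ier]|noer] := pselect (exists i : 'I_q, query o i \in erased adv o i).
    rewrite /tot (bigD1 i) //= ier addrCA lerDl addr_ge0 ?prodr_ge0 ?sumr_ge0 // => *; by rewrite ler0n.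
  rewrite /tot big1 ?lerDl ?sumr_ge0 // => r _.
  have /forallP/(_ r) : [forall r, cons (o r)].
    apply: decide_sound dec _ => i iq; apply/negP => ier; apply: noer.
    by exists (Ordinal iq).
  by move=> ->.
rewrite avgD avg_sum; apply: lerD; last first.
  apply: (@le_trans _ _ (\sum_(i < q) (q * t)%:R * ((p%:R ^+ m)^-1 + (p%:R ^+ n)^-1))).
    apply: ler_sum => i _; apply: le_trans (query_erased_prob vadv (ltn_ord i)) _.
    rewrite ler_wpM2r ?addr_ge0 ?invr_ge0 ?exprn_ge0 ?ler0n // ler_nat leq_mul2r.
    by rewrite (ltnW (ltn_ord i)) orbT.
  by rewrite sumr_const card_ord -mulnA -[leLHS]mulr_natl mulrA -natrM.
rewrite (avg_ffun_prod (fun _ b => (cons b)%:R)) prodr_const card_ord.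
set rho := avg (fun b => (~~ cons b)%:R) : R.
have -> : avg (fun b => (cons b)%:R) = 1 - rho.
  apply/esym/eqP; rewrite subr_eq; apply/eqP.
  rewrite -avgD -[LHS](avg_cst ((([ffun=> 0], 0), [ffun=> 0]) : block)).
  by apply: eq_avg => b; case: (cons b); rewrite /= ?addr0 ?add0r.
have rho1 : rho <= 1 by apply: avg_indicator_le1.
have far' : forall g, deg_le d g -> delta <= avg (fun x => (f x != g x)%:R).
  move=> g /far; rewrite /fdist avg_indicator.
  suff -> : #|[set x | f x != g x]| = #|[pred x | f x != g x]| by [].
  by apply: eq_card => x; rewrite !inE.
have h1 := cube_test_ge p_pr d1 d0 far'.
have h2 := avg_vdist_aff R dm f.
have h3 : avg (fun a : affine => vdist R d (fun z => f (aff a z))) / 2 <= rho.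
  rewrite mulrC -avgZ /rho [leRHS]avg_pair; apply: ler_avg => a.
  by rewrite mulrC; apply: block_reject.
apply: lerXn2r; rewrite ?nnegrE ?subr_ge0 //.
  rewrite ler_pdivrMr ?ltr0n ?muln_gt0 ?expn_gt0 // mul1r (le_trans d1) // ler1n.
  by rewrite !muln_gt0 !expn_gt0.
rewrite lerB // ler_pdivrMr ?ltr0n ?muln_gt0 ?expn_gt0 //.
apply: le_trans h1 _; rewrite [leRHS]mulrC [X in X * rho]natrM -[leRHS]mulrA; apply: ler_wpM2l; first exact: ler0n.
apply: le_trans h2 _; rewrite expnSr natrM natrX -[leRHS]mulrA; apply: ler_wpM2l.
  by rewrite exprn_ge0 ?ler0n.
by move: h3; lra.
Qed.

End Tester.

(** * Numerical estimates for the parameters *)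

Section QueryBudget.
Variable R : realType.

Lemma expRN1_le : expR (- 1) <= 1 / 2 :> R.
Proof.
have := expR_ge1Dx (1 : R); rewrite expRN => e2.
by rewrite div1r lef_pV2 ?posrE ?expR_gt0 //; lra.
Qed.

Lemma pow_one_sub_le (u : R) N c : u <= 1 -> c%:R <= u * N%:R ->
  (1 - u) ^+ N <= (1 / 2) ^+ c.
Proof.
move=> u1 cu; apply: (@le_trans _ _ (expR (- u) ^+ N)).
  apply: lerXn2r; rewrite ?nnegrE ?subr_ge0 ?expR_ge0 //; exact: expR_ge1Dx.
rewrite -expRM_natl; apply: (@le_trans _ _ (expR (c%:R * - 1))).
  by rewrite ler_expR !mulrN mulr1 lerN2 mulrC.
by rewrite expRM_natl; apply: lerXn2r; rewrite ?nnegrE ?expR_ge0 ?expRN1_le //; lra.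
Qed.

Lemma ln2_ge : 1 / 2 <= ln (2 : R).
Proof.
rewrite -[1 / 2]expRK ler_ln ?posrE ?expR_gt0 ?ltr0n //.
have := expR_ge1Dx (- (1 / 2) : R); rewrite expRN => h.
rewrite -[leLHS]invrK -[leRHS]invrK lef_pV2 ?posrE ?invr_gt0 ?expR_gt0 ?ltr0n //.
by lra.
Qed.

Lemma bernoulli_sub (z : R) N : 0 <= z -> z <= 1 -> 1 - N%:R * z <= (1 - z) ^+ N.
Proof.
move=> z0 z1; elim: N => [|N IH]; first by rewrite mul0r subr0.
rewrite exprSr; apply: (@le_trans _ _ ((1 - N%:R * z) * (1 - z))); last first.
  by rewrite ler_wpM2r // subr_ge0.
rewrite -natr1; have : 0 <= N%:R * z * z by rewrite !mulr_ge0 ?ler0n.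
lra.
Qed.

Lemma pow4_le_exp2 l : (l ^ 4 <= 64 * 2 ^ l)%N.
Proof.
(* Small cases by inspection; from 6 on, passing from l to l + 1 at most doubles the fourth
   power. *)
have [l6|l6] := leqP l 6; first by do 7 (case: l l6 => [|l] // l6).
rewrite -(subnKC (ltnW l6)); move: (l - 6)%N => k {l l6}.
elim: k => // k IH; rewrite addnS (expnS 2).
have : ((6 + k).+1 ^ 4 <= 2 * (6 + k) ^ 4)%N by rewrite !expnS !expn0; nia.
by move: IH; lia.
Qed.

Lemma card_low_exponents_gt0 p m d : prime p -> (0 < #|low_exponents p m d|)%N.
Proof.
move=> p_pr; apply/card_gt0P; exists [ffun=> Ordinal (prime_gt0 p_pr)].
by rewrite inE /mdeg big1 // => i _; rewrite ffunE.
Qed.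

(** Weight z = 1/(2m) in [card_low_exponents], with (1 - z)^m at least 1/2 by Bernoulli. Being
    polynomial in [m], this bound serves the query count. *)
Lemma card_low_exponents_poly p m d : (0 < m)%N ->
  #|low_exponents p m d|%:R <= 2 * (2 * m%:R) ^+ d :> R.
Proof.
move=> m0; have m0' : 1 <= m%:R :> R by rewrite ler1n.
have z0 : 0 < (2 * m%:R)^-1 :> R by rewrite invr_gt0; lra.
have z1 : (2 * m%:R)^-1 <= 1 / 2 :> R by rewrite div1r lef_pV2 ?posrE; lra.
have := @card_low_exponents p m d _ _ z0 (le_lt_trans z1 (ltac:(lra) : 1 / 2 < 1 :> R)).
have hb : 1 / 2 <= (1 - (2 * m%:R)^-1) ^+ m :> R.
  apply: le_trans (bernoulli_sub m (ltW z0) _); last by lra.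
  by rewrite invfM mulrCA divff ?pnatr_eq0 -?lt0n // mulr1; lra.
rewrite exprVn; set c := #|_|%:R; set e := (2 * m%:R) ^+ d => h.
have e0 : 0 < e by rewrite exprn_gt0 //; lra.
have ce0 : 0 <= c / e by rewrite divr_ge0 ?ler0n ?ltW.
have : c / e * (1 / 2) <= 1 by apply: le_trans h; rewrite ler_wpM2l.
by rewrite mulrAC ler_pdivrMr //; lra.
Qed.

(** Weight z = 1/21: the growth 21/20 per dimension is slow enough for p^M to absorb it in the
    erasure bound. *)
Lemma card_low_exponents_exp p m d :
  #|low_exponents p m d|%:R <= 21 ^+ d * (21 / 20) ^+ m :> R.
Proof.
have := @card_low_exponents p m d R 21^-1 ltac:(lra) ltac:(lra).
have -> : 1 - 21^-1 = (21 / 20)^-1 :> R by lra.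
by rewrite !exprVn -mulrA -invfM ler_pdivrMr ?mul1r // mulr_gt0 ?exprn_gt0 //; lra.
Qed.

(** One factor p absorbs lp^4, at most 128 p; each other factor beats (441/400)^2, which is below 2.
    Here 441/400 is (21/20)^2 and 900 is 30^2. *)
Lemma log_pow_le p M lp : prime p -> (0 < M)%N -> (2 ^ lp <= 2 * p)%N ->
  ((441 / 400) ^+ M * lp%:R ^+ 2 / 900) ^+ 2 <= p%:R ^+ M :> R.
Proof.
move=> p_pr; case: M => // M _ lp_p.
have lp4 : lp%:R ^+ 4 <= 128 * p%:R :> R.
  rewrite -natrX -natrM ler_nat; apply: leq_trans (pow4_le_exp2 lp) _.
  by move: lp_p; clear; lia.
have pow : ((441 / 400) ^+ 2) ^+ M <= p%:R ^+ M :> R.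
  apply: lerXn2r; rewrite ?nnegrE ?exprn_ge0 ?ler0n //; try by clear; lra.
  apply: (@le_trans _ _ 2); first by clear; lra.
  by rewrite ler_nat prime_gt1.
have sqE (a b c : R) : (c * a * b ^+ 2 / 900) ^+ 2 =
    a ^+ 2 * b ^+ 4 * (c ^+ 2 / 900 ^+ 2).
  by rewrite -exprVn; move: 900^-1 => u; ring.
rewrite (exprS _ M) sqE [((_ ^+ M) ^+ 2)]exprAC.
have pM0 : 0 <= p%:R ^+ M :> R by rewrite exprn_ge0 ?ler0n.
have h : ((441 / 400) ^+ 2) ^+ M * lp%:R ^+ 4 <= 128 * (p%:R ^+ M * p%:R) :> R.
  by rewrite [leRHS]mulrCA; apply: ler_pM => //; rewrite !exprn_ge0 ?ler0n // divr_ge0 ?ler0n.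
have pp0 : 0 <= p%:R ^+ M * p%:R :> R by rewrite mulr_ge0 ?ler0n.
rewrite (exprSr _ M).
move: (p%:R ^+ M * _) h pp0 => y; move: (_ * lp%:R ^+ 4) => x.
by clear; lra.
Qed.

(* The left side is at most [X ^ (10 d)] times a factor growing like
   [1.11 ^ M * (log p) ^ 2]; each of the two is at most the square root of [p ^ M]. *)
Lemma erasure_budget p d M lp (X : R) : prime p -> (0 < d)%N -> (0 < M)%N ->
    (2 ^ lp <= 2 * p)%N -> 30 <= X -> X ^+ (20 * d) <= p%:R ^+ M ->
  2 ^+ (28 * d) * #|low_exponents p (M + d) d|%:R ^+ 2 * lp%:R ^+ 2 * (X / 30) ^+ 2
    <= p%:R ^+ M.
Proof.
move=> p_pr d0 M0 lp_p X30 XM; set Q := p%:R ^+ M; set D := #|_|%:R.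
have X0 : 0 <= X by lra.
have X1 : 1 <= X by lra.
have Q0 : 0 <= Q by rewrite exprn_ge0 ?ler0n.
pose B : R := (441 / 400) ^+ M * lp%:R ^+ 2 / 900.
have B0 : 0 <= B by rewrite !mulr_ge0 ?exprn_ge0 ?invr_ge0 ?ler0n //; lra.
have hD : D <= X ^+ d * (21 / 20) ^+ M.
  apply: le_trans (card_low_exponents_exp p (M + d) d) _.
  rewrite exprD [_ ^+ M * _]mulrC mulrA -exprMn ler_wpM2r ?exprn_ge0 //; try lra.
  by apply: lerXn2r; rewrite ?nnegrE; lra.
have hD2 : D ^+ 2 <= X ^+ (2 * d) * (441 / 400) ^+ M.
  apply: le_trans (lerXn2r 2 _ _ hD) _; rewrite ?nnegrE ?ler0n ?mulr_ge0 ?exprn_ge0 //; try lra.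
  rewrite exprMn -!exprM mulnC [(M * 2)%N]mulnC [X in _ * X]exprM.
  by have -> : (21 / 20) ^+ 2 = 441 / 400 :> R by lra.
have h2 : 2 ^+ (28 * d) <= X ^+ (6 * d).
  rewrite !exprM; apply: lerXn2r; rewrite ?nnegrE ?exprn_ge0 ?ler0n //.
  apply: (@le_trans _ _ (30 ^+ 6)); first by clear; lra.
  by apply: lerXn2r; rewrite ?nnegrE; lra.
have hX : X ^+ 2 <= X ^+ (2 * d).
  by apply: ler_weXn2l => //; move: d0; clear; lia.
have step1 : 2 ^+ (28 * d) * D ^+ 2 * lp%:R ^+ 2 * (X / 30) ^+ 2 <= X ^+ (10 * d) * B.
  have -> : X ^+ (10 * d) * B = X ^+ (6 * d) * (X ^+ (2 * d) * (441 / 400) ^+ M)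
      * lp%:R ^+ 2 * (X ^+ (2 * d) / 900).
    have -> : (10 * d = 6 * d + 2 * d + 2 * d)%N by clear; lia.
    by rewrite !exprD /B; ring.
  apply: ler_pM; rewrite ?exprn_ge0 ?mulr_ge0 ?exprn_ge0 ?ler0n ?invr_ge0 //.
  - apply: ler_pM; rewrite ?exprn_ge0 ?mulr_ge0 ?exprn_ge0 ?ler0n ?invr_ge0 //.
    by apply: ler_pM; rewrite ?exprn_ge0 ?ler0n.
  - rewrite exprMn exprVn; have -> : 30 ^+ 2 = 900 :> R by lra.
    by rewrite ler_wpM2r ?invr_ge0 ?ler0n.
apply: le_trans step1 _.
have hB : B ^+ 2 <= Q by apply: log_pow_le.
clearbody B.
rewrite -(ler_pXn2r (isT : (0 < 2)%N)) ?nnegrE ?mulr_ge0 ?exprn_ge0 //.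
rewrite exprMn [Q ^+ 2]expr2; apply: ler_pM; rewrite ?exprn_ge0 //.
by rewrite -exprM (_ : (10 * d * 2 = 20 * d)%N) //; clear; lia.
Qed.

End QueryBudget.

(** Take logarithms: ln 2 is at least 1/2 and ln (30 U) at most 31 l, whence 1240 = 2 * 20 * 31. *)
Lemma subspace_dim_bound (R : realType) p d M (U : R) : prime p -> (0 < d)%N ->
    0 <= U -> p%:R ^+ M < (30 * U) ^+ (20 * d) ->
  M%:R <= (1240 * d)%:R * Num.max 1 (ln (1 + U)).
Proof.
move=> p_pr d0 U0 pM; set l := Num.max _ _.
have l1 : 1 <= l by rewrite le_max lexx.
have lU : ln (1 + U) <= l by rewrite le_max lexx orbT.
have p2 : (2 <= p)%N by apply: prime_gt1.
have U0' : 0 < U.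
  rewrite lt_neqAle U0 andbT; apply/eqP => U00; move: pM.
  by rewrite -U00 mulr0 expr0n muln_eq0 /= (gtn_eqF d0) ltNge exprn_ge0 ?ler0n.
have lnM2 : M%:R * ln (2 : R) <= (20 * d)%:R * ln (30 * U).
  rewrite (mulr_natl _ M) (mulr_natl _ (20 * d)) -!lnXn ?ltr0n ?mulr_gt0 ?ltr0n // ler_ln ?posrE ?exprn_gt0 ?ltr0n ?mulr_gt0 ?ltr0n //.
  apply: le_trans (ltW pM); apply: lerXn2r; rewrite ?nnegrE ?ler0n // ler_nat //.
have lnX : ln (30 * U) <= 31 * l.
  apply: (@le_trans _ _ (ln (30 * (1 + U)))).
    rewrite ler_ln ?posrE ?mulr_gt0 ?ltr0n //; lra.
  rewrite lnM ?posrE ?ltr0n //; try lra.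
  have := @ln_sublinear R 30 ltac:(lra); lra.
have := ler_wpM2l (ler0n R M) (ln2_ge R).
have := ler_wpM2l (ler0n R (20 * d)) lnX.
rewrite !natrM; lra.
Qed.

Lemma block_count_bound d : (4 * (2 ^ d.+1 * d.+2 * 2 ^ d.+2) <= 2 ^ (3 * d + 6))%N.
Proof.
have h : (d.+2 <= 2 ^ d.+1)%N by apply: ltn_expl.
have -> : (2 ^ (3 * d + 6) = 4 * (2 ^ d.+1 * 2 ^ d.+1 * 2 ^ d.+2))%N.
  rewrite -(expnD 2) -(expnD 2) (_ : 4 = 2 ^ 2)%N // -(expnD 2); congr (_ ^ _)%N.
  by clear; lia.
by rewrite leq_mul2l /= leq_mul2r leq_mul2l h !orbT.
Qed.

Lemma point_count_bound d D lp : (0 < D)%N -> (0 < lp)%N ->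
  ((2 ^ d * (D * lp + 1)).+1 <= 2 ^ (d + 2) * D * lp)%N.
Proof.
move=> D0 lp0; have : (0 < D * lp)%N by rewrite muln_gt0 D0.
have : (0 < 2 ^ d)%N by rewrite expn_gt0.
by rewrite expnD -mulnA; move: (D * lp)%N (2 ^ d)%N; clear; nia.
Qed.

Lemma query_count_bound (R : realType) d D lp L (delta : R) :
    (0 < D)%N -> (0 < lp)%N -> 0 < delta ->
    L%:R <= 4 * (2 ^ d.+1 * d.+2 * 2 ^ d.+2)%:R / delta ->
  (L * (2 ^ d * (D * lp + 1)).+1)%:R <= 2 ^+ (4 * d + 8) * D%:R * lp%:R / delta.
Proof.
move=> D0 lp0 del0 LKb; rewrite natrM.
apply: (le_trans (ler_wpM2r (ler0n _ _) LKb)).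
rewrite mulrAC ler_wpM2r ?invr_ge0 ?(ltW del0) // -natrX -!natrM ler_nat.
apply: leq_trans (leq_mul (block_count_bound d) (point_count_bound d D0 lp0)) _.
by rewrite !mulnA -expnD (_ : 3 * d + 6 + (d + 2) = 4 * d + 8)%N //; clear; lia.
Qed.

(** At most 2^(D lp) polynomials compete, and every 2^d points at least halve the survival bound of
    each. *)
Lemma interpolation_count (R : realType) p m d lp : prime p -> (p < 2 ^ lp)%N ->
  #|vpoly p m d|%:R *
    (1 - (2 ^+ d)^-1) ^+ (2 ^ d * (#|low_exponents p m d| * lp + 1)) <= 1 / 2 :> R.
Proof.
move=> p_pr lp_gt; set D := #|low_exponents p m d|.
have h1 : #|vpoly p m d|%:R <= 2 ^+ (D * lp) :> R.
  rewrite -natrX ler_nat; apply: leq_trans (card_vpoly m d p_pr) _.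
  rewrite -/D mulnC expnM; case: (D) => [//|D']; by rewrite leq_exp2r // ltnW.
have inv1 : (2 ^+ d)^-1 <= 1 :> R by rewrite invf_le1 ?exprn_gt0 ?exprn_ege1 ?ler1n.
have h2 : (1 - (2 ^+ d)^-1) ^+ (2 ^ d * (D * lp + 1)) <= (1 / 2) ^+ (D * lp + 1) :> R.
  apply: pow_one_sub_le => //.
  by rewrite natrM natrX mulrA mulVf ?mul1r // expf_neq0 // pnatr_eq0.
apply: le_trans (ler_pM _ _ h1 h2) _; rewrite ?exprn_ge0 ?ler0n ?subr_ge0 //.
rewrite exprD mulrA -exprMn (_ : 2 * (1 / 2) = 1) ?expr1n ?mul1r ?expr1 //.
by clear; lra.
Qed.

(** Both inverse powers are at most p^-M, so it suffices that 12 q^2 t is at most p^M, which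
    [erasure_budget] gives with X = 30 t / delta. *)
Lemma total_erasure_bound (R : realType) p d M n lp q t (delta : R) :
    prime p -> (0 < d)%N -> (0 < M)%N -> (M <= n)%N -> (2 ^ lp <= 2 * p)%N ->
    0 < delta -> delta <= 1 -> (30 * (t%:R / delta)) ^+ (20 * d) <= p%:R ^+ M ->
    q%:R <= 2 ^+ (4 * d + 8) * #|low_exponents p (M + d) d|%:R * lp%:R / delta ->
  (q * q * t)%:R * ((p%:R ^+ (M + d))^-1 + (p%:R ^+ n)^-1) <= 1 / 6 :> R.
Proof.
move=> p_pr d0 M0 Mn lp_p del0 del1; set U := t%:R / delta => XM.
set A := _ * lp%:R => q_le.
(* [erasure_budget] needs X at least 30, that is t / delta at least 1, so t = 0 is treated apart. *)
have [t00|t0] := posnP t; first by rewrite t00 muln0 mul0r divr_ge0.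
have p1 : 1 <= p%:R :> R by rewrite ler1n prime_gt0.
have Q0 : 0 < p%:R ^+ M :> R by rewrite exprn_gt0 // ltr0n prime_gt0.
have inv_le k : (M <= k)%N -> (p%:R ^+ k)^-1 <= (p%:R ^+ M)^-1 :> R.
  move=> Mk; rewrite lef_pV2 ?posrE ?exprn_gt0 ?ltr0n ?prime_gt0 //.
  exact: ler_weXn2l.
have t1 : 1 <= t%:R :> R by rewrite ler1n.
have U1 : 1 <= U by rewrite ler_pdivlMr // mul1r (le_trans del1).
have main : 12 * (q * q * t)%:R <= p%:R ^+ M :> R.
  have X30 : 30 <= 30 * U by rewrite ler_peMr.
  apply: le_trans (erasure_budget p_pr d0 M0 lp_p X30 XM).
  rewrite [30 * U]mulrC mulfK ?pnatr_eq0 //.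
  have hq : q%:R ^+ 2 * t%:R <= A ^+ 2 * U ^+ 2.
    have h : q%:R ^+ 2 <= (A / delta) ^+ 2.
      by apply: lerXn2r; rewrite ?nnegrE ?ler0n // (le_trans _ q_le) ?ler0n.
    have tt : t%:R <= t%:R ^+ 2 :> R by rewrite expr2 ler_peMl ?ler0n.
    apply: le_trans (ler_pM _ _ h tt) _; rewrite ?exprn_ge0 ?ler0n //.
    by rewrite (exprMn _ A) /U (exprMn _ t%:R) mulrAC -mulrA.
  have -> : (q * q * t)%:R = q%:R ^+ 2 * t%:R :> R by rewrite !natrM expr2.
  apply: (@le_trans _ _ (12 * (A ^+ 2 * U ^+ 2))); first by rewrite ler_wpM2l ?ler0n.
  rewrite mulrA ler_wpM2r ?exprn_ge0 ?(le_trans ler01) // /A.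
  rewrite (exprMn 2 _ lp%:R) (exprMn 2 _ #|_|%:R) !mulrA.
  do 4 (apply: ler_wpM2r; first exact: ler0n).
  (* Here 12 is at most 2^4, and 4 + 2 (4 d + 8) is at most 28 d since d is positive. *)
  rewrite -mulrA -exprD; apply: (@le_trans _ _ (2 ^+ 4 * 2 ^+ (4 * d + 8 + (4 * d + 8)))).
    by rewrite ler_wpM2r ?exprn_ge0 ?ler0n // -natrX ler_nat.
  by rewrite -exprD; apply: ler_weXn2l; [rewrite ler1n|move: d0; clear; lia].
apply: (@le_trans _ _ ((q * q * t)%:R * (2 / p%:R ^+ M))).
  rewrite ler_wpM2l ?ler0n // [2 / _]mulr_natl mulr2n.
  by apply: lerD; apply: inv_le; rewrite ?leq_addr.
rewrite mulrA ler_pdivrMr //; move: main; move: (p%:R ^+ M) (q * q * t)%:R => x y.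
by clear; lra.
Qed.

(** [D] is O(m^d), hence O(l^d), and l^d is at most l^(3d+3) as l is at least 1; [lp] goes into the
    constant. *)
Lemma query_complexity_bound (R : realType) d D lp m (l : R) : 1 <= l ->
    D%:R <= 2 * (2 * m%:R) ^+ d :> R -> m%:R <= (1242 * d)%:R * l ->
  2 ^+ (4 * d + 8) * D%:R * lp%:R
    <= (2 ^ (4 * d + 9) * lp * (2484 * d) ^ d)%:R * l ^+ (3 * d + 3).
Proof.
move=> l1 Dm m_le; have l0 := le_trans ler01 l1.
have D_le : D%:R <= 2 * ((2484 * d)%:R * l) ^+ d.
  apply: le_trans Dm _; rewrite ler_wpM2l ?ler0n //.
  apply: lerXn2r; rewrite ?nnegrE ?mulr_ge0 ?ler0n //.
  have -> : (2484 * d)%:R = 2 * (1242 * d)%:R :> R by rewrite -natrM mulnA.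
  by rewrite -mulrA ler_wpM2l ?ler0n.
apply: (@le_trans _ _ (2 ^+ (4 * d + 8) * (2 * ((2484 * d)%:R * l) ^+ d) * lp%:R)).
  by rewrite ler_wpM2r ?ler0n // ler_wpM2l ?exprn_ge0 ?ler0n.
apply: (@le_trans _ _ ((2 ^ (4 * d + 9) * lp * (2484 * d) ^ d)%:R * l ^+ d)).
  have -> : (2 ^ (4 * d + 9) = 2 * 2 ^ (4 * d + 8))%N by rewrite -expnS addnS.
  rewrite (exprMn d) (natrM _ _ ((2484 * d) ^ d)) (natrM _ _ lp) (natrM _ 2).
  rewrite (natrX _ _ d) (natrX _ 2).
  move: (2 ^+ _) ((2484 * d)%:R ^+ d) (l ^+ d) (lp%:R) => a b x c.
  suff -> : a * (2 * (b * x)) * c = 2 * a * c * b * x by [].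
  by clear; ring.
by rewrite ler_wpM2l ?ler0n //; apply: ler_weXn2l => //; clear; lia.
Qed.

(** * Choice of the parameters and conclusion *)

Theorem theorem1p1 (R : realType) (p d : nat) (hp : prime p) (hd : (0 < d)%N) :
  exists C : R, 0 < C /\
  forall (n : nat) (delta : R) (t : nat),
    (0 < n)%N -> 0 < delta -> delta <= 1 ->
    t%:R <= delta / 30 * powR p%:R (n%:R / (20 * d)%:R) ->
    exists (Omega : finType) (w : Omega -> R) (q : nat)
           (qry : Omega -> seq (answer p) -> point p n)
           (dec : Omega -> seq (answer p) -> bool),
      is_distribution w /\
      q%:R <= C * (Num.max 1 (ln (1 + t%:R / delta))) ^+ (3 * d + 3) / delta /\
      (* completeness *)
      (forall f : point p n -> 'F_p, deg_le d f ->
         forall adv, valid_adversary t adv ->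
           accept_prob w q qry dec f adv = 1) /\
      (* soundness *)
      (forall f : point p n -> 'F_p, far_from_deg delta d f ->
         forall adv, valid_adversary t adv ->
           1 - accept_prob w q qry dec f adv >= 2 / 3).
Proof.
have p2 : (2 <= p)%N by apply: prime_gt1.
(* The number of binary digits of p: 2^lp exceeds p and is at most 2 p. *)
pose lp := (trunc_log 2 p).+1.
have /andP[lp_le lp_gt] : (2 ^ trunc_log 2 p <= p < 2 ^ lp)%N.
  by apply: trunc_log_bounds => //; apply: prime_gt0.
exists (2 ^ (4 * d + 9) * lp * (2484 * d) ^ d)%:R; split.
  by rewrite ltr0n !muln_gt0 !expn_gt0 !muln_gt0 hd.
move=> n delta t n0 del0 del1 tle.
pose U := t%:R / delta; pose X := 30 * U.
have U0 : 0 <= U by rewrite divr_ge0 ?ler0n ?ltW.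
have X0 : 0 <= X by rewrite mulr_ge0 ?ler0n.
have Xn : X ^+ (20 * d) <= p%:R ^+ n.
  have -> : p%:R ^+ n = (powR p%:R (n%:R / (20 * d)%:R) : R) ^+ (20 * d).
    rewrite -[RHS]powR_mulrn ?powR_ge0 // -powRrM divfK ?powR_mulrn ?ler0n //.
    by rewrite pnatr_eq0 muln_eq0 -lt0n.
  apply: lerXn2r; rewrite ?nnegrE ?powR_ge0 //.
  by rewrite /X /U mulrA ler_pdivrMr //; move: tle; lra.
have exM : exists k, (0 < k)%N && (X ^+ (20 * d) <= p%:R ^+ k).
  by exists n; rewrite n0.
(* [XM] keeps erasures rare, and minimality keeps the query count polylogarithmic in t / delta. The
   hypothesis on t says that n qualifies, so M is at most n. *)
have [M /andP[M0 XM] Mmin] := ex_minnP exM.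
have Mn : (M <= n)%N by apply: Mmin; rewrite n0.
pose m := (M + d)%N; pose D := #|low_exponents p m d|.
pose s := (2 ^ d * (D * lp + 1))%N.
pose Kb := (2 ^ d.+1 * d.+2 * 2 ^ d.+2)%N.
(* Enough blocks for (1 - delta / Kb)^(L+1) to drop to 1/8. *)
pose L := Num.truncn (3 * Kb%:R / delta).
pose q := (L.+1 * s.+1)%N.
have dm : (d < m)%N by rewrite /m -add1n leq_add2r.
have D0 : (0 < D)%N by apply: card_low_exponents_gt0.
have Kb0 : (0 < Kb)%N by rewrite /Kb !muln_gt0 !expn_gt0.
have Kb1 : 1 <= Kb%:R :> R by rewrite ler1n.
have KbL : 3 * Kb%:R / delta <= L.+1%:R by apply/ltW/truncnS_gt.
have LKb : L.+1%:R <= 4 * Kb%:R / delta.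
  have : L%:R <= 3 * Kb%:R / delta.
    by rewrite truncn_le // !mulr_ge0 ?invr_ge0 ?ler0n // ltW.
  have : 1 <= Kb%:R / delta by rewrite ler_pdivlMr // mul1r (le_trans del1).
  rewrite -(natr1 L) -!mulrA; move: (Kb%:R / delta) (L%:R) => y x; clear; lra.
have q_le : q%:R <= 2 ^+ (4 * d + 8) * D%:R * lp%:R / delta.
  exact: query_count_bound.
have interp : #|vpoly p m d|%:R * (1 - (2 ^+ d)^-1) ^+ s <= 1 / 2 :> R.
  exact: interpolation_count.
have erase_le : (q * q * t)%:R * ((p%:R ^+ m)^-1 + (p%:R ^+ n)^-1) <= 1 / 6 :> R.
  apply: (total_erasure_bound hp hd M0 Mn _ del0 del1 XM q_le).
  by rewrite /lp expnS leq_mul2l.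
pose Omega := {ffun 'I_L.+1 -> ({ffun 'I_m -> 'rV['F_p]_n} * 'rV['F_p]_n)
                 * {ffun 'I_s.+1 -> 'rV['F_p]_m}}.
have o0 : Omega := [ffun=> (([ffun=> 0], 0), [ffun=> 0])].
exists Omega, (fun=> #|Omega|%:R^-1), q, (fun o ans => query o (size ans)),
  (fun o => decide d o).
have accE f adv : accept_prob (fun _ : Omega => #|Omega|%:R^-1 : R) q
    (fun (o : Omega) ans => query o (size ans)) (fun o : Omega => decide d o) f adv
  = avg (fun o : Omega => (decide d o (run_answers q f (fun ans => query o (size ans)) adv))%:R).
  by rewrite /accept_prob -mulr_sumr mulrC /avg; congr (_ / _).
split; [|split; [|split]].
- split=> [o|]; first by rewrite invr_ge0 ler0n.
  rewrite sumr_const -[_ *+ _]mulr_natr mulVf // pnatr_eq0 -lt0n.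
  by apply/card_gt0P; exists o0.
- apply: le_trans q_le _; rewrite ler_wpM2r ?invr_ge0 ?(ltW del0) //.
  rewrite -/U; set l := Num.max _ _.
  have l1 : 1 <= l by rewrite le_max lexx.
  apply: query_complexity_bound => //.
    by apply: card_low_exponents_poly; apply: leq_ltn_trans dm.
  (* Minimality rules out M - 1 only if M - 1 is positive; for M = 1 the bound is trivial. *)
  have M_le : M.-1%:R <= (1240 * d)%:R * l.
    case: (leqP M 1) => M1.
      have -> : M.-1 = 0%N by move: M1; case: (M) => [|[|]].
      by rewrite !mulr_ge0 // (le_trans ler01).
    apply: (@subspace_dim_bound R p) => //; rewrite ltNge; apply/negP => XM'.
    have := Mmin M.-1; rewrite XM' andbT; move: M1; clear; lia.
  (* The remaining d + 1 is at most 2 d, which turns 1240 into 1242. *)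
  have -> : m = (M.-1 + (d + 1))%N by rewrite /m; move: M0; clear; lia.
  have d1 : (d + 1)%:R <= (2 * d)%:R * l.
    apply: (@le_trans _ _ ((2 * d)%:R * 1)).
      by rewrite mulr1 ler_nat; move: hd; clear; lia.
    by rewrite ler_wpM2l ?ler0n.
  rewrite natrD (_ : (1242 * d = 1240 * d + 2 * d)%N); last by clear; lia.
  by rewrite [(1240 * d + _)%:R]natrD [leRHS]mulrDl; apply: lerD.
- move=> f fd adv vadv; rewrite accE -[RHS](avg_cst o0); apply: eq_avg => o.
  by rewrite decide_complete.
- move=> f far adv vadv; rewrite accE.
  have := accept_le L hp dm (ltW del0) del1 far vadv interp; rewrite -/Kb -/q.
  (* The blocks contribute 1/8 and the erasures 1/6, together less than 1/3. *)
  have : (1 - delta / Kb%:R) ^+ L.+1 <= (1 / 2) ^+ 3.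
    apply: pow_one_sub_le; first by rewrite ler_pdivrMr ?ltr0n // mul1r (le_trans del1).
    move: KbL; rewrite ler_pdivrMr // => h.
    by rewrite mulrAC ler_pdivlMr ?ltr0n // mulrC [delta * _]mulrC mulrC.
  move: erase_le; move: (avg _) (_ ^+ L.+1) (_%:R * _) => x y z; clear; lra.
Qed.
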